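(* Let $\Lambda$ be a finite measure on $[0,1]$ with $\Lambda(\{1\})=0$, and let $(\Pi_t)_{t\geq 0}$ be the $\Lambda$-coalescent. For $n\in\mathbb{Z}$ let $\mu^n=\int_0^1 x^n\Lambda(dx)$ (with the convention $1/0=\infty$). For $t>0$ let $N^a_t=|\{b\in\Pi_t : \mathrm{freq}(b)>0\}|$ be the number of atomic blocks of $\Pi_t$. Suppose that $\mu^{-1}<\infty$. If $\mu^{-2}=\infty$ then $\mathbb{P}[\forall t>0,\ N^a_t=\infty]=1$, whereas if $\mu^{-2}<\infty$ then $\mathbb{P}[\forall t>0,\ N^a_t<\infty]=1$.
   Context: For $n\in\mathbb{N}$, let $\iota_n$ be the restriction map from partitions of $\mathbb{N}$ to partitions of $\{1,\dots,n\}$. The $\Lambda$-coalescent is the Markov process $(\Pi_t)_{t\ge 0}$ with values in partitions of $\mathbb{N}$, started from the partition of $\mathbb{N}$ into singletons, such that for every $n$, $\iota_n(\Pi_t)$ is a Markov chain in which, whenever it has $i$ blocks, each particular $k$-tuple of blocks ($2\le k\le i$) merges into one block at rate $\lambda_{i,k}=\int_0^1x^{k-2}(1-x)^{i-k}\Lambda(dx)$, independently of all other $k$-tuples. For each $t>0$, $\Pi_t$ is an exchangeable partition, so almost surely every block $b$ has an asymptotic frequency $\mathrm{freq}(b)=\lim_{k\to\infty}|b\cap\{1,\dots,k\}|/k$. A block with $\mathrm{freq}(b)>0$ is called atomic. *)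

(* Defs.v *)
From HB Require Import structures.
From mathcomp Require Import all_boot all_order all_algebra.
From mathcomp Require Import all_classical all_reals all_analysis.
Set Implicit Arguments. Unset Strict Implicit. Unset Printing Implicit Defensive.
Import Order.TTheory GRing.Theory Num.Theory.
Import numFieldNormedType.Exports.
Local Open Scope ring_scope.

(* A partition of N = {0,1,2,...} is encoded by its (boolean) equivalence
   relation E : nat -> nat -> bool; the block of i is the predicate E i. *)
Definition equiv_rel (E : nat -> nat -> bool) : Prop :=
  (forall i, E i i) /\ (forall i j, E i j -> E j i) /\
  (forall i j k, E i j -> E j k -> E i k).

Definition restr (n : nat) (E : nat -> nat -> bool) : {set {set 'I_n}} :=
  [set [set j : 'I_n | E i j] | i : 'I_n].

Definition singletonsN (i j : nat) : bool := i == j.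
Definition singletons (n : nat) : {set {set 'I_n}} := [set [set i] | i : 'I_n].

Definition merge n (x S : {set {set 'I_n}}) : {set {set 'I_n}} :=
  (x :\: S) :|: [set finset.cover S].

Section Coalescent.
Local Open Scope classical_set_scope.
Variable R : realType.
Variable Lambda : {finite_measure set R -> \bar R}.

Definition lam (i k : nat) : R :=
  fine (\int[Lambda]_(x in `[0%R, 1%R]) ((x ^+ (k - 2)) * ((1 - x) ^+ (i - k)))%:E)%E.

Definition rate n (x y : {set {set 'I_n}}) : R :=
  \sum_(S in powerset x | (2 <= #|S|)%N && (merge x S == y)) lam #|x| #|S|.

Definition gen n (x y : {set {set 'I_n}}) : R :=
  rate x y - (x == y)%:R * \sum_z rate x z.

Fixpoint genpow n (k : nat) (x y : {set {set 'I_n}}) : R :=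
  match k with
  | 0 => (x == y)%:R
  | k'.+1 => \sum_z genpow k' x z * gen z y
  end.

Definition trans n (t : R) (x y : {set {set 'I_n}}) : R :=
  limn (fun N => \sum_(0 <= k < N) (t ^+ k / (k`!)%:R * genpow k x y)).

Definition mu_neg (m : nat) : \bar R :=
  (\int[Lambda]_(x in `[0%R, 1%R]) (if x == 0%R then +oo else (x ^- m)%:E))%E.

End Coalescent.

Local Open Scope classical_set_scope.

Definition atomic (R : realType) (b : pred nat) : Prop :=
  exists2 l : R, 0 < l &
    (fun k : nat => (count b (iota 0 k))%:R / k%:R) @ \oo --> l.

Definition atomic_blocks (R : realType) (E : nat -> nat -> bool) : set (set nat) :=
  [set B | exists i, B = [set j | E i j] /\ atomic R (E i)].

Definition is_Lambda_coalescent (R : realType)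
    (Lambda : {finite_measure set R -> \bar R})
    d (Omega : measurableType d) (P : probability Omega R)
    (Pi : R -> Omega -> nat -> nat -> bool) : Prop :=
  (forall t w, equiv_rel (Pi t w)) /\
  (forall t i j, measurable [set w | Pi t w i j]) /\
  (forall w, Pi 0 w = singletonsN) /\
  (forall n w t, 0 <= t -> exists2 e : R, 0 < e &
      forall s, t <= s < t + e -> restr n (Pi s w) = restr n (Pi t w)) /\
  (forall n w t, 0 < t -> exists2 e : R, 0 < e & exists x,
      forall s, t - e < s < t -> restr n (Pi s w) = x) /\
  (* every restriction is the Markov chain with generator Q_n started from
     singletons: finite-dimensional distributions *)
  (forall n (k : nat) (ts : nat -> R) (xs : nat -> {set {set 'I_n}}),
      ts 0%N = 0 -> xs 0%N = singletons n ->
      (forall j, (j < k)%N -> ts j <= ts j.+1) ->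
      P [set w | forall j, (1 <= j <= k)%N -> restr n (Pi (ts j) w) = xs j]
      = (\prod_(1 <= j < k.+1) trans Lambda (ts j - ts j.-1) (xs j.-1) (xs j))%:E).

(* Main.v *)
Require Import Defs.
From HB Require Import structures.
From mathcomp Require Import all_boot all_order all_algebra perm.
From mathcomp Require Import all_classical all_reals all_analysis.
From mathcomp Require Import measurable_realfun.
From mathcomp Require Import ring lra zify.
Set Implicit Arguments. Unset Strict Implicit. Unset Printing Implicit Defensive.
Import Order.TTheory GRing.Theory Num.Theory.
Import numFieldNormedType.Exports.
Local Open Scope classical_set_scope.
Local Open Scope ring_scope.

(** Every probabilistic estimate is an instance of Dynkin's formula for the pair
    of the restrictions of the coalescent at two times: the drift of a function
    of the restricted partition is the integral against [p ^- 2 Lambda(dp)] of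
    its expected change when each block takes part in a merger independently
    with probability [p].

    If [mu^{-2}] is finite, the number of non-singleton blocks has upward drift
    at most [mu^{-2}], so its total increase along any time grid has bounded
    expectation; atomic blocks are not singletons.

    If [mu^{-2}] is infinite, the rate of leaving the partition into singletons
    is unbounded in [n]. Since a given block takes part in a merger at rate at
    most [mu^{-1}], [k] non-singleton blocks present at a small time [s'] survive
    until a small time [s] with probability close to [1]; they are distinct from
    a block that is formed after [s'], so the number of non-singleton blocks at
    small times is unbounded. A logarithmic Lyapunov function shows that among
    many blocks many survive unchanged up to any fixed time (here
    [Lambda {1} = 0] is used). Blocks common to [Pi s] and [Pi T] are blocks of
    [Pi t] for all [t] between [s] and [T], and non-singleton blocks at the fixed
    time [s] are atomic, by exchangeability and a law of large numbers. *)

(** * Power series of exponential type *)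

Section ExponentialSeries.
Variable R : realType.

Definition egf (a : nat -> R) (t : R) : R :=
  limn (pseries (fun k => a k / k`!%:R) t).

Lemma is_cvg_egf (a : nat -> R) (A C t : R) : 0 <= C ->
  (forall k, `|a k| <= A * C ^+ k) -> cvgn (pseries (fun k => a k / k`!%:R) t).
Proof.
move=> C0 aC.
have A0 : 0 <= A by have := aC 0%N; rewrite expr0 mulr1; apply: le_trans.
apply: normed_cvg; rewrite /normed_series_of /=.
apply: (@series_le_cvg _ _ (A *: exp_coeff (C * `|t|))) => [k|k|k|] /=.
- exact: normr_ge0.
- by rewrite mulr_ge0 ?divr_ge0 ?exprn_ge0 ?mulr_ge0 ?ler0n.
- rewrite normrM normrX normrM normfV normr_nat.
  rewrite -[leRHS]/(A * ((C * `|t|) ^+ k / k`!%:R)) exprMn.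
  rewrite [leRHS](_ : _ = A * C ^+ k / k`!%:R * `|t| ^+ k); last by ring.
  by rewrite ler_wpM2r ?exprn_ge0// ler_wpM2r ?invr_ge0.
- exact/is_cvg_seriesZ/is_cvg_series_exp_coeff.
Qed.

Lemma is_derive_egf (a : nat -> R) (A C t : R) : 0 <= C ->
  (forall k, `|a k| <= A * C ^+ k) ->
  is_derive t 1 (egf a) (egf (fun k => a k.+1) t).
Proof.
move=> C0 aC.
have diffs (b : nat -> R) : pseries_diffs (fun k => b k / k`!%:R) =
    (fun k => b k.+1 / k`!%:R).
  apply/funext => i; rewrite /pseries_diffs factS natrM invfM.
  rewrite [LHS](_ : _ = (i.+1%:R / i.+1%:R) * (b i.+1 / i`!%:R)); last by ring.
  by rewrite divff ?mul1r ?pnatr_eq0.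
have aC1 k : `|a k.+1| <= A * C * C ^+ k by rewrite -mulrA -exprS.
have aC2 k : `|a k.+2| <= A * C * C * C ^+ k by rewrite -mulrA -exprS.
have := @pseries_snd_diffs R (fun k => a k / k`!%:R) (`|t| + 1) t.
rewrite !diffs; apply.
- exact: is_cvg_egf aC.
- exact: is_cvg_egf aC1.
- exact: is_cvg_egf aC2.
- by rewrite [ltRHS]ger0_norm ?addr_ge0// ltrDl.
Qed.

Lemma egf_sum (I : finType) (a : I -> nat -> R) (c : I -> R) (A C t : R) :
  0 <= C -> (forall i k, `|a i k| <= A * C ^+ k) ->
  egf (fun k => \sum_i a i k * c i) t = \sum_i egf (a i) t * c i.
Proof.
move=> C0 aC; apply/cvg_lim => //.
have -> : pseries (fun k => (\sum_i a i k * c i) / k`!%:R) t =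
    (fun N => \sum_i pseries (fun k => a i k / k`!%:R) t N * c i).
  apply/funext => N; rewrite /pseries /series /=.
  under [RHS]eq_bigr do rewrite mulr_suml.
  rewrite exchange_big /=; apply: eq_bigr => k _.
  by rewrite !mulr_suml; apply: eq_bigr => i _; ring.
apply: cvg_big => [|i _]; first exact: add_continuous.
apply: cvgMl.
exact: is_cvg_egf (aC i).
Qed.

End ExponentialSeries.

(** * Random subsets *)

Section BinomialWeight.
Import mathcomp.boot.fintype mathcomp.boot.finset.
Variables (R : realFieldType) (I : finType).
Implicit Types (z S B : {set I}) (p : R).

(* The probability of [S] when each element of [z] is kept with probability [p]. *)
Definition bw z p S : R := p ^+ #|S| * (1 - p) ^+ (#|z| - #|S|).

Lemma bw_ge0 z p S : 0 <= p <= 1 -> 0 <= bw z p S.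
Proof. by move=> /andP[p0 p1]; rewrite mulr_ge0// exprn_ge0// subr_ge0. Qed.

Lemma sum_bw z p : \sum_(S in powerset z) bw z p S = 1.
Proof.
pose F i := if i \in z then p else 0.
pose G i := if i \in z then 1 - p else 1.
have : \prod_(i : I) (F i + G i) = 1.
  by rewrite big1// /F /G => i _; case: ifP => _; ring.
rewrite (bigA_distr 1 +%R) => H; rewrite -[RHS]H {H}.
rewrite [RHS](bigID (mem (powerset z))) /= [X in _ = _ + X]big1 ?addr0.
  apply: eq_bigr => S; rewrite powersetE => Sz.
  rewrite (bigID (mem S)) /=; congr (_ * _).
    rewrite -prodr_const; apply: eq_bigr => i iS.
    by rewrite iS /F (subsetP Sz).
  rewrite (bigID (mem z)) /= [X in _ = _ * X]big1 ?mulr1; last first.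
    by move=> i /andP[iS iz]; rewrite (negbTE iS) /G (negbTE iz).
  transitivity (\prod_(i in z :\: S) (1 - p)).
    by rewrite prodr_const cardsD (setIidPr Sz).
  apply: eq_big => [i|i]; first by rewrite inE.
  by rewrite inE => /andP[/negbTE-> iz]; rewrite /G iz.
move=> S; rewrite powersetE => /subsetPn[i iS iz].
by rewrite (bigD1 i)//= iS /F (negbTE iz) mul0r.
Qed.

Lemma bwU1 z p a S : a \in z -> a \notin S -> S \subset z ->
  (1 - p) * bw z p (a |: S) = p * bw z p S.
Proof.
move=> az aS Sz; rewrite /bw cardsU1 aS add1n exprS.
have lt : (#|S| < #|z|)%N.
  by apply: proper_card; rewrite properE Sz; apply/subsetPn; exists a.
by rewrite -(subnSK lt) exprS; ring.
Qed.

Lemma bw_swap z p B (h : I -> {set I} -> R) : B \subset z ->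
  (1 - p) * \sum_(S in powerset z) \sum_(a in B :&: S) bw z p S * h a S =
  p * \sum_(S in powerset z) \sum_(a in B :\: S) bw z p S * h a (a |: S).
Proof.
move=> Bz.
transitivity (\sum_(a in B) \sum_(S in powerset z | a \in S)
    (1 - p) * (bw z p S * h a S)).
  rewrite (exchange_big_dep (fun a => a \in B)) /=; last first.
    by move=> S a _; rewrite inE => /andP[].
  rewrite mulr_sumr; apply: eq_bigr => a aB; rewrite mulr_sumr.
  by apply: eq_bigl => S; rewrite in_setI aB.
transitivity (\sum_(a in B) \sum_(S in powerset z | a \notin S)
    p * (bw z p S * h a (a |: S))); last first.
  rewrite [in RHS](exchange_big_dep (fun a => a \in B)) /=; last first.
    by move=> S a _; rewrite inE => /andP[].
  rewrite [RHS]mulr_sumr; apply: eq_bigr => a aB; rewrite [RHS]mulr_sumr.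
  by apply: eq_bigl => S; rewrite in_setD aB andbT.
apply: eq_bigr => a aB.
have az : a \in z by apply: (subsetP Bz).
rewrite (reindex_onto (fun S => a |: S) (fun S => S :\ a)) /=; last first.
  by move=> S /andP[_ aS]; rewrite setD1K.
apply: eq_big => [S|S].
  rewrite !powersetE subUset sub1set az setU11 andbT /=.
  apply/andP/andP => -[Sz aS]; split => //.
    by rewrite -(eqP aS) !inE eqxx.
  by rewrite setU1K.
move=> /andP[/andP[]]; rewrite powersetE => Sz _ /eqP aS.
have {}aS : a \notin S by rewrite -aS !inE eqxx.
have Sz' : S \subset z by apply: subset_trans Sz; exact: subsetUr.
by rewrite [LHS]mulrA [RHS]mulrA bwU1.
Qed.

Lemma sum_bw_cardI z p B : B \subset z ->
  \sum_(S in powerset z) bw z p S * #|B :&: S|%:R = p * #|B|%:R.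
Proof.
move=> Bz; have := bw_swap p (fun _ _ => 1) Bz.
set s := \sum_(S in _) bw z p S * _.
rewrite [X in _ * X = _](_ : _ = s); last first.
  by apply: eq_bigr => S _; rewrite sumr_const /= mulr1 mulr_natr.
rewrite [X in _ = _ * X](_ : _ = #|B|%:R - s); first by lra.
rewrite -[#|B|%:R]mul1r -[X in _ = X * _ - _](sum_bw z p) mulr_suml -sumrB.
apply: eq_bigr => S _; rewrite sumr_const mulr1 -mulrBr cardsD.
by rewrite -natrB ?mulr_natr// subset_leq_card// subsetIl.
Qed.

Lemma sum_bw_ratio z p B : B \subset z -> 0 <= p < 1 ->
  \sum_(S in powerset z) bw z p S * (#|B :&: S|%:R / #|B :\: S|.+1%:R)
    <= p / (1 - p).
Proof.
move=> Bz /andP[p0 p1].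
have p01 : 0 <= p <= 1 by rewrite p0 ltW.
rewrite ler_pdivlMr ?subr_gt0// mulrC.
have -> : \sum_(S in powerset z) bw z p S * (#|B :&: S|%:R / #|B :\: S|.+1%:R) =
    \sum_(S in powerset z) \sum_(a in B :&: S) bw z p S * (#|B :\: S|.+1%:R)^-1.
  by apply: eq_bigr => S _; rewrite sumr_const -mulr_natr; ring.
rewrite (@bw_swap z p B (fun _ S => (#|B :\: S|.+1%:R)^-1)) // -[leRHS]mulr1.
rewrite ler_wpM2l// -[leRHS](sum_bw z p); apply: ler_sum => S _.
under eq_bigr => a.
  rewrite inE => /andP[aS aB].
  have -> : (#|B :\: (a |: S)|.+1 = #|B :\: S|)%N.
    rewrite [RHS](cardsD1 a) inE aS aB /= add1n; congr (_.+1).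
    by apply: eq_card => x; rewrite !inE negb_or andbA.
  over.
rewrite -mulr_sumr sumr_const -[_ *+ _]mulr_natr -[leRHS]mulr1.
rewrite ler_wpM2l ?bw_ge0//.
have [->|n0] := eqVneq #|B :\: S| 0%N; first by rewrite mulr0.
by rewrite mulVf// pnatr_eq0.
Qed.

Lemma sum_bw_card_lt2 z p : 0 <= p <= 1 ->
  p * (#|z|%:R - 1) * \sum_(S in powerset z | (#|S| < 2)%N) bw z p S <= 2.
Proof.
move=> p01; have /andP[p0 p1] := p01.
have [z1|z1] := ltnP #|z| 1.
  have z0 : #|z| = 0%N by move: z1; rewrite ltnS leqn0 => /eqP.
  rewrite z0 sub0r mulrN1 mulNr (le_trans _ (ler0n _ 2))// oppr_le0.
  by rewrite mulr_ge0// sumr_ge0// => S _; rewrite bw_ge0.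
have := @bw_swap z p z (fun _ S => (#|S|%:R)^-1) (subxx _).
set L := _ * _ => LE.
have L1 : L <= 1.
  rewrite /L -[leRHS]mulr1 ler_pM ?subr_ge0//.
  - by apply: sumr_ge0 => S _; apply: sumr_ge0 => a _; rewrite mulr_ge0 ?bw_ge0 ?invr_ge0.
  - by rewrite gerBl.
  - rewrite -[leRHS](sum_bw z p); apply: ler_sum => S; rewrite powersetE => Sz.
    rewrite -mulr_sumr sumr_const (setIidPr Sz) -[_ *+ _]mulr_natr -[leRHS]mulr1.
    rewrite ler_wpM2l ?bw_ge0//.
    have [->|n0] := eqVneq #|S| 0%N; first by rewrite mulr0.
    by rewrite mulVf// pnatr_eq0.
move: L1; rewrite LE => {L LE}; set X := \sum_(S in _) _ => L1.
suff Xle : (#|z|%:R - 1) * (\sum_(S in powerset z | (#|S| < 2)%N) bw z p S) <= 2 * X.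
  by have := ler_wpM2l p0 Xle; lra.
rewrite -ler_pdivrMl// /X.
rewrite [in leRHS](bigID (fun S => #|S| < 2)%N) /= -[leLHS]addr0 lerD//; last first.
  by apply: sumr_ge0 => S _; apply: sumr_ge0 => a _; rewrite mulr_ge0 ?bw_ge0 ?invr_ge0.
rewrite mulr_sumr mulr_sumr; apply: ler_sum => S /andP[]; rewrite powersetE => Sz S2.
under eq_bigr => a.
  by rewrite inE => /andP[aS _]; rewrite cardsU1 aS add1n; over.
rewrite -mulr_sumr sumr_const -[X in _ <= _ * X]mulr_natr cardsD (setIidPr Sz).
rewrite [leLHS](_ : _ = bw z p S * (2^-1 * (#|z|%:R - 1))); last by ring.
rewrite ler_wpM2l ?bw_ge0// natrB ?subset_leq_card//.
have [->|->] : #|S| = 0%N \/ #|S| = 1%N by case: #|S| S2 => [|[|]]//; [left|right].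
  rewrite invr1 subr0; have : 1 <= #|z|%:R :> R by rewrite ler1n.
  by lra.
by lra.
Qed.

End BinomialWeight.

(** * The generator of the restricted chain *)

Section Generator.
Variables (R : realType) (Lambda : {finite_measure set R -> \bar R}) (n : nat).
Implicit Types (x y z : {set {set 'I_n}}).

Lemma genpow_bound : exists2 C : R, 0 <= C &
  forall k x y, `|genpow Lambda k x y| <= 1 * C ^+ k.
Proof.
exists (\sum_(x : {set {set 'I_n}}) \sum_(y : {set {set 'I_n}}) `|gen Lambda x y|).
  by apply: sumr_ge0 => x _; apply: sumr_ge0.
set C := \sum_x _.
elim=> [|k IH] x y /=; first by rewrite expr0 mulr1; case: (x == y); rewrite ?normr1 ?normr0.
rewrite mul1r exprSr (le_trans (ler_norm_sum _ _ _))//.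
apply: (@le_trans _ _ (\sum_z C ^+ k * `|gen Lambda z y|)).
  by apply: ler_sum => z _; rewrite normrM ler_wpM2r// -[leRHS]mul1r.
rewrite -mulr_sumr ler_wpM2l//.
  by rewrite exprn_ge0//; apply: sumr_ge0 => z _; apply: sumr_ge0.
apply: ler_sum => z _; rewrite (bigD1 y)//= lerDl; exact: sumr_ge0.
Qed.

Lemma trans_egf t x y :
  trans Lambda t x y = egf (fun k => genpow Lambda k x y) t.
Proof.
rewrite /trans /egf; congr (lim (_ @ \oo)); apply/funext => N.
by apply: eq_bigr => k _; rewrite /=; ring.
Qed.

Lemma is_derive_trans (t : R) x y : is_derive t 1 (fun t => trans Lambda t x y)
  (\sum_z trans Lambda t x z * gen Lambda z y).
Proof.
have [C C0 bC] := genpow_bound.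
have -> : (fun t => trans Lambda t x y) = egf (fun k => genpow Lambda k x y).
  by apply/funext => u; exact: trans_egf.
under eq_bigr do rewrite trans_egf.
rewrite -(egf_sum _ _ C0 (fun z k => bC k x z)).
exact: (is_derive_egf _ C0 (fun k => bC k x y)).
Qed.

Lemma trans0 x y : trans Lambda 0 x y = (x == y)%:R.
Proof.
rewrite /trans; apply/cvg_lim => //; rewrite -cvg_shiftS /=.
rewrite (_ : (fun _ => _) = cst ((x == y)%:R)); first exact: cvg_cst.
apply/funext => N; rewrite big_nat_recl//= big1 ?addr0.
  by rewrite expr0 divr1 mul1r.
by move=> k _; rewrite expr0n/= !mul0r.
Qed.

Lemma rate_sum z (g : {set {set 'I_n}} -> R) :
  \sum_y rate Lambda z y * g y =
  \sum_(S in powerset z | (2 <= #|S|)%N) lam Lambda #|z| #|S| * g (Defs.merge z S).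
Proof.
rewrite [RHS](partition_big (fun S => Defs.merge z S) predT)//=.
apply: eq_bigr => y _; rewrite /rate mulr_suml.
apply: eq_big => [S|S]; first by rewrite andbA.
by move=> /andP[_ /andP[_ /eqP ->]].
Qed.

Lemma gen_sum z (g : {set {set 'I_n}} -> R) :
  \sum_y gen Lambda z y * g y =
  \sum_(S in powerset z | (2 <= #|S|)%N)
     lam Lambda #|z| #|S| * (g (Defs.merge z S) - g z).
Proof.
under [RHS]eq_bigr do rewrite mulrBr.
rewrite sumrB -rate_sum.
have <- : \sum_y rate Lambda z y * g z = \sum_(S in powerset z | (2 <= #|S|)%N)
     lam Lambda #|z| #|S| * g z by rewrite (rate_sum z (fun _ => g z)).
rewrite /gen; under eq_bigr do rewrite mulrBl.
rewrite sumrB; congr (_ - _).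
rewrite (bigD1 z)//= eqxx mul1r [X in _ + X]big1 ?addr0; first by rewrite mulr_suml.
by move=> y yz; rewrite eq_sym (negbTE yz) !mul0r.
Qed.

Lemma is_derive_bigsum (I : Type) (r : seq I) (f : I -> R -> R) (df : I -> R) (t : R) :
  (forall i, is_derive t 1 (f i) (df i)) ->
  is_derive t 1 (fun t => \sum_(i <- r) f i t) (\sum_(i <- r) df i).
Proof.
move=> dfi; elim: r => [|i r IH].
  rewrite big_nil (_ : (fun _ => _) = cst 0); first exact: is_derive_cst.
  by apply/funext => u; rewrite big_nil.
rewrite big_cons (_ : (fun _ => _) = f i + (fun t => \sum_(i <- r) f i t)).
  exact: is_deriveD.
by apply/funext => u; rewrite big_cons.
Qed.

Lemma is_derive_trans_sum (p : {set {set 'I_n}} -> R)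
    (f : {set {set 'I_n}} -> {set {set 'I_n}} -> R) (t : R) :
  is_derive t 1 (fun t => \sum_x \sum_y p x * trans Lambda t x y * f x y)
    (\sum_x \sum_z p x * trans Lambda t x z * \sum_y gen Lambda z y * f x y).
Proof.
apply: is_derive_bigsum => x.
have -> : \sum_z p x * trans Lambda t x z * (\sum_y gen Lambda z y * f x y) =
    \sum_y p x * f x y * (\sum_z trans Lambda t x z * gen Lambda z y).
  under eq_bigr do rewrite mulr_sumr.
  rewrite exchange_big /=; apply: eq_bigr => y _; rewrite mulr_sumr.
  by apply: eq_bigr => z _; ring.
apply: is_derive_bigsum => y.
have -> : (fun t => p x * trans Lambda t x y * f x y) =
    (p x * f x y) *: (fun t => trans Lambda t x y).
  by apply/funext => u; rewrite mulrAC.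
by apply: is_deriveZ; exact: is_derive_trans.
Qed.

End Generator.

(** * Finite-valued random variables *)

Section FiniteValued.
Variables (R : realType) (d : measure_display) (Omega : measurableType d).
Variable P : probability Omega R.

Definition pr (A : set Omega) : R := fine (P A).

Lemma pr_fin A : measurable A -> P A = (pr A)%:E.
Proof. by move=> mA; rewrite /pr fineK// fin_num_measure. Qed.

Lemma pr_ge0 A : 0 <= pr A.
Proof. by rewrite /pr fine_ge0. Qed.

Lemma pr_setT : pr setT = 1.
Proof. by rewrite /pr probability_setT. Qed.

Lemma le_pr A B : measurable A -> measurable B -> A `<=` B -> pr A <= pr B.
Proof.
move=> mA mB AB; rewrite -lee_fin -!pr_fin//.
by apply: le_measure; rewrite ?inE.
Qed.

Lemma prU_le A B : measurable A -> measurable B -> pr (A `|` B) <= pr A + pr B.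
Proof.
move=> mA mB; rewrite -lee_fin EFinD -!pr_fin//; last exact: measurableU.
exact: measureU2.
Qed.

Lemma pr_bigcup_le (A : (set Omega)^nat) (e : R) : (forall k, measurable (A k)) ->
  nondecreasing_seq A -> (forall k, pr (A k) <= e) -> pr (\bigcup_k A k) <= e.
Proof.
move=> mA ndA Ae.
have mU : measurable (\bigcup_k A k) by exact: bigcupT_measurable.
have cv := nondecreasing_cvg_mu (mu := P) mA mU ndA.
rewrite -lee_fin -pr_fin// -(cvg_lim _ cv)//.
apply: lime_le; first by apply/cvg_ex; eexists; exact: cv.
by apply: nearW => k /=; rewrite pr_fin// lee_fin.
Qed.

Lemma negligible_small (A : set Omega) :
  (forall e : R, 0 < e -> exists B, [/\ measurable B, A `<=` B & pr B <= e]) ->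
  P.-negligible A.
Proof.
move=> H.
have /choice[B HB] : forall k : nat, exists B, [/\ measurable B, A `<=` B & pr B <= k.+1%:R^-1].
  by move=> k; apply: H; rewrite invr_gt0.
have mB : measurable (\bigcap_k B k) by apply: bigcapT_measurable => k; have [] := HB k.
exists (\bigcap_k B k); split => //; last by move=> w Aw k _; have [_ + _] := HB k; exact.
rewrite pr_fin//; congr (_%:E); apply/eqP; rewrite eq_le pr_ge0 andbT.
apply/ler_addgt0Pl => e e0; rewrite addr0.
have [mk _ ek] := HB (Num.truncn e^-1).
apply: (@le_trans _ _ (pr (B (Num.truncn e^-1)))).
  by apply: le_pr => // w; apply.
apply: le_trans ek _; rewrite invf_ple ?posrE//; exact/ltW/truncnS_gt.
Qed.

Section FiniteType.
Variables (T : finType) (X : Omega -> T).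
Hypothesis mX : forall x, measurable [set w | X w = x].

Lemma preimage_finE (Q : pred T) :
  [set w | Q (X w)] = \bigcup_(x in [set` enum Q]) [set w | X w = x].
Proof.
apply/seteqP; split => [w Qw|w [x /= + Xw]].
  by exists (X w) => //=; rewrite mem_enum.
by rewrite mem_enum Xw.
Qed.

Lemma measurable_fin (Q : pred T) : measurable [set w | Q (X w)].
Proof. by rewrite preimage_finE; apply: fin_bigcup_measurable. Qed.

Lemma pr_finE (Q : pred T) :
  pr [set w | Q (X w)] = \sum_(x | Q x) pr [set w | X w = x].
Proof.
apply: EFin_inj; rewrite -pr_fin; last exact: measurable_fin.
rewrite preimage_finE measure_fin_bigcup//; last first.
  by move=> x y _ _ [w [/= -> ->]].
rewrite -fsbig_seq ?enum_uniq//= big_enum /= -sumEFin.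
by apply: eq_bigr => x _; exact: pr_fin.
Qed.

Lemma sum_pr_fin : \sum_x pr [set w | X w = x] = 1.
Proof. by rewrite -(pr_finE predT) -pr_setT; congr pr; apply/seteqP; split. Qed.

Lemma markov_fin (Q : pred T) (f : T -> R) : (forall x, 0 <= f x) ->
  (forall x, Q x -> 1 <= f x) ->
  pr [set w | Q (X w)] <= \sum_x pr [set w | X w = x] * f x.
Proof.
move=> f0 f1; rewrite pr_finE [leRHS](bigID Q) /= -[leLHS]addr0 lerD//.
  by apply: ler_sum => x /f1 fx; rewrite ler_peMr// pr_ge0.
by apply: sumr_ge0 => x _; rewrite mulr_ge0// pr_ge0.
Qed.

End FiniteType.

Lemma measurable_ffun (I : finType) (Y : I -> Omega -> bool) :
  (forall i, measurable [set w | Y i w]) ->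
  forall f : {ffun I -> bool}, measurable [set w | [ffun i => Y i w] = f].
Proof.
move=> mY f.
have -> : [set w | [ffun i => Y i w] = f] = \bigcap_(i in [set: I]) [set w | Y i w = f i].
  apply/seteqP; split => [w /= <- i _|w Yf]; first by rewrite /= ffunE.
  by apply/ffunP => i; rewrite ffunE; exact: Yf.
apply: fin_bigcap_measurable => // i _; case: (f i); first exact: mY.
rewrite (_ : [set w | _] = ~` [set w | Y i w]); first exact: measurableC.
apply/seteqP; split => w /=; first by move=> /negbT/negP.
by move=> /negP/negbTE.
Qed.

End FiniteValued.

(** * Dynkin's formula *)

Section Partitions.
Import mathcomp.boot.fintype mathcomp.boot.finset.
Variable n : nat.
Implicit Types (x y z S : {set {set 'I_n}}) (i j : 'I_n).

Definition joined z i j := [exists b in z, (i \in b) && (j \in b)].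

Lemma joined_restr (E : nat -> nat -> bool) i j :
  Defs.equiv_rel E -> joined (restr n E) i j = E i j.
Proof.
move=> [refl [sym tr]]; apply/exists_inP/idP.
  move=> [_ /imsetP[k _ ->]]; rewrite !inE => /andP[ki kj].
  exact: tr (sym _ _ ki) kj.
by move=> Eij; exists [set j : 'I_n | E i j]%SET; [exact: imset_f|rewrite !inE refl Eij].
Qed.

Lemma mem_merge z S b : b \in z -> b \notin S -> b \in Defs.merge z S.
Proof. by move=> bz bS; rewrite !inE bS bz. Qed.

Lemma joined_merge z S i j : joined z i j -> joined (Defs.merge z S) i j.
Proof.
move=> /exists_inP[b bz /andP[ib jb]]; apply/exists_inP.
have [bS|bS] := boolP (b \in S); last by exists b; [exact: mem_merge|rewrite ib].
exists (cover S); first by rewrite !inE eqxx orbT.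
by apply/andP; split; apply/bigcupP; exists b.
Qed.

End Partitions.

Section Coalescent.
Variables (R : realType) (Lambda : {finite_measure set R -> \bar R}).
Variables (d : measure_display) (Omega : measurableType d) (P : probability Omega R).
Variable Pi : R -> Omega -> nat -> nat -> bool.
Hypothesis coal : is_Lambda_coalescent Lambda P Pi.

Lemma equiv_coal t w : Defs.equiv_rel (Pi t w).
Proof. by have [H _] := coal. Qed.

Lemma measurable_coal t i j : measurable [set w | Pi t w i j].
Proof. by have [_ [H _]] := coal. Qed.

Lemma measurable_restr n t x : measurable [set w | restr n (Pi t w) = x].
Proof.
pose Y (ij : 'I_n * 'I_n) w := Pi t w ij.1 ij.2.
have mY : forall ij, measurable [set w | Y ij w] by move=> ij; exact: measurable_coal.
pose r (f : {ffun 'I_n * 'I_n -> bool}) :=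
  [set [set j : 'I_n | f (i, j)] | i : 'I_n]%SET.
have := measurable_fin (measurable_ffun mY) (fun f => r f == x).
congr measurable; apply/seteqP.
have rE w : r [ffun ij => Y ij w] = restr n (Pi t w).
  by apply: eq_imset => i; apply/setP => j; rewrite !inE ffunE.
by split => w /=; rewrite rE => /eqP.
Qed.

Lemma measurable_restr2 n s t (xy : {set {set 'I_n}} * {set {set 'I_n}}) :
  measurable [set w | (restr n (Pi s w), restr n (Pi t w)) = xy].
Proof.
case: xy => x y.
rewrite (_ : mkset _ = [set w | restr n (Pi s w) = x] `&`
                       [set w | restr n (Pi t w) = y]).
  by apply: measurableI; exact: measurable_restr.
by apply/seteqP; split => w /=; [case=> -> ->|case=> -> ->].
Qed.

Lemma coal0 n w : restr n (Pi 0 w) = Defs.singletons n.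
Proof.
have [_ [_ [-> _]]] := coal; apply: eq_imset => i; apply/setP => j.
by rewrite !inE /singletonsN eq_sym.
Qed.

Lemma coal_right_const w (t : R) i j : 0 <= t -> exists2 e : R, 0 < e &
  forall s, t <= s < t + e -> Pi s w i j = Pi t w i j.
Proof.
move=> t0; have [_ [_ [_ [/(_ (maxn i j).+1 w t t0) + _]]]] := coal.
move=> [e e0 He]; exists e => // s /He Hs.
have ilt : (i < (maxn i j).+1)%N by rewrite ltnS leq_maxl.
have jlt : (j < (maxn i j).+1)%N by rewrite ltnS leq_maxr.
rewrite -(joined_restr (Ordinal ilt) (Ordinal jlt) (equiv_coal s w)) Hs.
exact: joined_restr (equiv_coal t w).
Qed.

Lemma pr_restr n (s : R) x : 0 <= s ->
  pr P [set w | restr n (Pi s w) = x] = trans Lambda s (Defs.singletons n) x.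
Proof.
move=> s0; have [_ [_ [_ [_ [_ fdd]]]]] := coal.
pose ts k : R := if k is 0%N then 0 else s.
pose xs k := if k is 0%N then Defs.singletons n else x.
have := fdd n 1%N ts xs erefl erefl.
rewrite big_nat1 /= subr0 => fddE; apply: EFin_inj; rewrite -fddE; last by case.
rewrite -pr_fin; last exact: measurable_restr.
congr (P _); apply/seteqP; split => w /=.
  by move=> sx [|[|]].
by move=> /(_ 1%N erefl).
Qed.

Lemma pr_restr2 n (s t : R) x y : 0 <= s -> s <= t ->
  pr P [set w | (restr n (Pi s w), restr n (Pi t w)) = (x, y)] =
  trans Lambda s (Defs.singletons n) x * trans Lambda (t - s) x y.
Proof.
move=> s0 st; have [_ [_ [_ [_ [_ fdd]]]]] := coal.
pose ts k : R := if k is k'.+1 then (if k' is 0%N then s else t) else 0.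
pose xs k := if k is k'.+1 then (if k' is 0%N then x else y) else Defs.singletons n.
have := fdd n 2%N ts xs erefl erefl.
rewrite big_nat_recr//= big_nat1 /= subr0 => fddE; apply: EFin_inj; rewrite -fddE; last first.
  by case=> [|[|]].
rewrite -pr_fin; last exact: measurable_restr2.
congr (P _); apply/seteqP; split => w /=.
  by case=> sx ty [|[|[|]]].
by move=> H; rewrite (H 1%N erefl) (H 2%N erefl).
Qed.

Lemma dynkin n (s t : R) (f : {set {set 'I_n}} -> {set {set 'I_n}} -> R) (c : R) :
  0 <= s -> s <= t ->
  (forall x z, \sum_(S in powerset z | (2 <= #|S|)%N)
     lam Lambda #|z| #|S| * (f x (Defs.merge z S) - f x z) <= c) ->
  \sum_xy pr P [set w | (restr n (Pi s w), restr n (Pi t w)) = xy] * f xy.1 xy.2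
  <= \sum_x pr P [set w | restr n (Pi s w) = x] * f x x + c * (t - s).
Proof.
move=> s0 st fc.
pose p x := trans Lambda s (Defs.singletons n) x.
pose u r := \sum_x \sum_y p x * trans Lambda r x y * f x y.
have -> : \sum_xy pr P [set w | (restr n (Pi s w), restr n (Pi t w)) = xy] * f xy.1 xy.2 =
    u (t - s).
  by rewrite /u pair_bigA; apply: eq_bigr => -[x y] _; rewrite pr_restr2.
have -> : \sum_x pr P [set w | restr n (Pi s w) = x] * f x x = u 0.
  apply: eq_bigr => x _; rewrite pr_restr// (bigD1 x)//= trans0 eqxx mulr1.
  rewrite big1 ?addr0// => y yx.
  by rewrite trans0 eq_sym (negbTE yx) mulr0 mul0r.
pose du r := \sum_x \sum_z p x * trans Lambda r x z * \sum_y gen Lambda z y * f x y.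
have dus (r : R) : is_derive r 1 u (du r) by exact: is_derive_trans_sum.
have ts0 : 0 <= t - s by rewrite subr_ge0.
have ucont : {within `[0, t - s]%classic, continuous u}.
  by apply: derivable_within_continuous => r _; exact: ex_derive.
have [r + ur] := MVT_segment ts0 (fun r _ => dus r) ucont.
rewrite in_itv /= => /andP[r0 _].
move: ur; rewrite subr0 => /eqP; rewrite subr_eq => /eqP ->.
rewrite addrC lerD2l ler_wpM2r//.
have prE x z : p x * trans Lambda r x z =
    pr P [set w | (restr n (Pi s w), restr n (Pi (s + r) w)) = (x, z)].
  by rewrite pr_restr2// ?lerDl// [s + r]addrC addrK.
have := sum_pr_fin P (@measurable_restr2 n s (s + r)) => sum1.
rewrite -[leRHS]mul1r -sum1 mulr_suml /du pair_bigA /=.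
apply: ler_sum => -[x z] _ /=; rewrite prE ler_wpM2l ?pr_ge0// gen_sum; exact: fc.
Qed.

Lemma pr_dynkin n (s t : R) (Q : {set {set 'I_n}} -> {set {set 'I_n}} -> bool)
    (f : {set {set 'I_n}} -> {set {set 'I_n}} -> R) (c : R) :
  0 <= s -> s <= t -> (forall x z, 0 <= f x z) -> (forall x z, Q x z -> 1 <= f x z) ->
  (forall x z, \sum_(S in powerset z | (2 <= #|S|)%N)
     lam Lambda #|z| #|S| * (f x (Defs.merge z S) - f x z) <= c) ->
  pr P [set w | Q (restr n (Pi s w)) (restr n (Pi t w))]
  <= \sum_x pr P [set w | restr n (Pi s w) = x] * f x x + c * (t - s).
Proof.
move=> s0 st f0 f1 fc; apply: le_trans (dynkin s0 st fc).
have := @markov_fin _ _ _ P _ _ (@measurable_restr2 n s t)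
  (fun xy => Q xy.1 xy.2) (fun xy => f xy.1 xy.2).
by apply => [xy|xy] //; exact: f1.
Qed.

Lemma measurable_restr_pred n s (Q : pred {set {set 'I_n}}) :
  measurable [set w | Q (restr n (Pi s w))].
Proof. exact: measurable_fin (@measurable_restr n s) Q. Qed.

Lemma measurable_restr_pred2 n s t (Q : {set {set 'I_n}} -> {set {set 'I_n}} -> bool) :
  measurable [set w | Q (restr n (Pi s w)) (restr n (Pi t w))].
Proof. exact: measurable_fin (@measurable_restr2 n s t) (fun xy => Q xy.1 xy.2). Qed.

Lemma sum_pr_restr_pred n s (Q : pred {set {set 'I_n}}) :
  \sum_x pr P [set w | restr n (Pi s w) = x] * (Q x)%:R =
  pr P [set w | Q (restr n (Pi s w))].
Proof.
rewrite (pr_finE P (@measurable_restr n s)) [RHS]big_mkcond /=.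
by apply: eq_bigr => x _; case: (Q x); rewrite ?mulr1 ?mulr0.
Qed.

Lemma lam_ge0 i k : 0 <= lam Lambda i k.
Proof.
apply: fine_ge0; apply: integral_ge0 => x /=; rewrite in_itv /= => /andP[x0 x1].
by rewrite lee_fin mulr_ge0 ?exprn_ge0// subr_ge0.
Qed.

Lemma pr_not_refine (s t : R) i j : 0 <= s -> s <= t ->
  pr P [set w | Pi s w i j && ~~ Pi t w i j] = 0.
Proof.
move=> s0 st.
have ilt : (i < (maxn i j).+1)%N by rewrite ltnS leq_maxl.
have jlt : (j < (maxn i j).+1)%N by rewrite ltnS leq_maxr.
pose Q (x z : {set {set 'I_(maxn i j).+1}}) :=
  joined x (Ordinal ilt) (Ordinal jlt) && ~~ joined z (Ordinal ilt) (Ordinal jlt).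
have -> : [set w | Pi s w i j && ~~ Pi t w i j] =
    [set w | Q (restr _ (Pi s w)) (restr _ (Pi t w))].
  by apply/seteqP; split => w /=; rewrite /Q !joined_restr//; exact: equiv_coal.
apply/eqP; rewrite eq_le pr_ge0 andbT.
apply: le_trans (@pr_dynkin _ s t Q (fun x z => (Q x z)%:R) 0 s0 st _ _ _) _.
- by [].
- by move=> x z ->.
- move=> x z; apply: sumr_le0 => S _; rewrite mulr_ge0_le0 ?lam_ge0// subr_le0 ler_nat.
  rewrite /Q; case: (joined x _ _) => //=.
  by case: (boolP (joined z _ _)) => //= [/joined_merge->//|_]; exact: leq_b1.
- rewrite mul0r addr0 big1// => x _.
  by rewrite /Q andbN mulr0.
Qed.

Lemma ae_coal_refine : {ae P, forall w, forall s t : R, 0 <= s -> s <= t ->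
  forall i j, Pi s w i j -> Pi t w i j}.
Proof.
pose N (q : rat * rat * (nat * nat)) := [set w |
  [&& 0 <= ratr q.1.1 :> R, ratr q.1.1 <= ratr q.1.2 :> R,
   Pi (ratr q.1.1) w q.2.1 q.2.2 & ~~ Pi (ratr q.1.2) w q.2.1 q.2.2]].
pose F k := if unpickle k is Some q then N q else set0.
have NF : P.-negligible (\bigcup_k F k).
  apply: negligible_bigcup => k; rewrite /F; case: unpickle => [[[q r] [i j]]|]; last first.
    exact: negligible_set0.
  rewrite /N /=.
  have [/andP[q0 qr]|nqr] := boolP ((0 <= ratr q :> R) && (ratr q <= ratr r :> R)); last first.
    rewrite (_ : mkset _ = set0); first exact: negligible_set0.
    apply/seteqP; split => w //=; rewrite andbA (negbTE nqr).
    by [].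
  have mA : measurable [set w | Pi (ratr q) w i j && ~~ Pi (ratr r) w i j].
    rewrite (_ : mkset _ = [set w | Pi (ratr q) w i j] `&` ~` [set w | Pi (ratr r) w i j]).
      by apply: measurableI; [|apply: measurableC]; exact: measurable_coal.
    by apply/seteqP; split => w /=; [move=> /andP[-> /negP]|move=> [-> /negP]].
  rewrite q0 qr /=; apply/negligibleP => //.
  exact: etrans (pr_fin P mA) (congr1 EFin (pr_not_refine _ _ q0 qr)).
apply: negligibleS NF => w /=; apply: contra_notP => nF s t s0 st i j sij.
have [e e0 He] := coal_right_const w i j s0.
have t0 : 0 <= t by exact: le_trans st.
have [e' e0' He'] := coal_right_const w i j t0.
move: st; rewrite le_eqVlt => /predU1P[<-//|st].
have [q] : exists q : rat, s < ratr q < Num.min (s + e) t.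
  have : s < Num.min (s + e) t by rewrite lt_min ltrDl e0.
  by move=> /rat_in_itvoo[q]; rewrite in_itv /=; exists q.
rewrite lt_min => /andP[sq /andP[qse qt]].
have [r /andP[tr rt]] : exists r : rat, t < ratr r < t + e'.
  have : t < t + e' by rewrite ltrDl.
  by move=> /rat_in_itvoo[r]; rewrite in_itv /=; exists r.
apply: contra_notT nF => ntij.
exists (pickle (q, r, (i, j))); first exact: I.
rewrite /F pickleK /N /mkset [(q, r, (i, j)).1]/= [(q, r, (i, j)).2]/=.
rewrite [(q, r).1]/= [(q, r).2]/= [(i, j).1]/= [(i, j).2]/=.
rewrite (le_trans s0 (ltW sq)) (ltW (lt_trans qt tr)) /=.
by rewrite He ?sij ?(ltW sq)// He' ?(ltW tr).
Qed.

End Coalescent.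

(** * Merger rates as integrals *)

Section LambdaIntegrals.
Variables (R : realType) (Lambda : {finite_measure set R -> \bar R}).
Hypothesis L1 : Lambda [set 1%R] = 0%E.
Hypothesis mu1 : (mu_neg Lambda 1 < +oo)%E.

Local Notation D0 := (`[0%R, 1%R]%classic : set R).
Local Notation D := (`]0%R, 1%R[%classic : set R).

Lemma measurable_invX (m : nat) : measurable_fun [set x : R | 0 < x] (fun x : R => x ^- m).
Proof.
apply: open_continuous_measurable_fun; first exact: open_gt.
move=> x; rewrite inE /= => x0.
apply: cvgV; first by rewrite expf_neq0// gt_eqF.
exact: exprn_continuous.
Qed.

Lemma measurable_invXD (m : nat) : measurable_fun D (fun x : R => x ^- m).
Proof.
apply: measurable_funS (measurable_invX m).
  by apply: open_measurable; exact: open_gt.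
by move=> x /=; rewrite in_itv /= => /andP[].
Qed.

Lemma measurable_mu_neg (m : nat) : measurable_fun D0
  (fun x : R => if x == 0%R then +oo%E else (x ^- m)%:E).
Proof.
apply: measurable_fun_if => //.
- by apply: measurable_fun_eqr => //; exact: measurable_cst.
- apply/measurable_EFinP; apply: measurable_funS (measurable_invX m).
    by apply: open_measurable; exact: open_gt.
  move=> x [/=]; rewrite in_itv /= => /andP[x0 _] xn0.
  by rewrite lt_neqAle x0 andbT eq_sym xn0.
Qed.

Lemma mu_neg_ge0 (m : nat) (x : R) : D0 x ->
  (0 <= (if x == 0%R then +oo%E else (x ^- m)%:E))%E.
Proof.
rewrite /= in_itv /= => /andP[x0 _]; case: ifP => _; first exact: leey.
by rewrite lee_fin invr_ge0 exprn_ge0.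
Qed.

Lemma Lambda_set0 : Lambda [set 0%R] = 0%E.
Proof.
apply/eqP/negPn/negP => L0; move: mu1; apply/negP; rewrite -leNgt.
have <- : (\int[Lambda]_(x in [set 0%R]) cst +oo%E x = +oo)%E.
  by rewrite integral_cst// gt0_mulye// lt0e L0 measure_ge0.
rewrite (eq_integral (fun x : R => if x == 0%R then +oo%E else (x ^- 1)%:E)); last first.
  by move=> x; rewrite inE /= => ->; rewrite eqxx.
apply: ge0_subset_integral => //.
- exact: measurable_mu_neg.
- exact: mu_neg_ge0.
- by move=> x /= ->; rewrite in_itv /= lexx ler01.
Qed.

Lemma integral_itvD (f : R -> \bar R) : measurable_fun D0 f ->
  (forall x, D0 x -> 0 <= f x)%E ->
  (\int[Lambda]_(x in D0) f x = \int[Lambda]_(x in D) f x)%E.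
Proof.
move=> mf f0.
have mN : measurable ([set 0%R : R] `|` [set 1%R]) by exact: measurableU.
rewrite (ge0_negligible_integral mN)//.
  congr (integral _ _ _); apply/seteqP; split => x /=; rewrite !in_itv /=.
    move=> [/andP[x0 x1] /not_orP[/eqP xn0 /eqP xn1]].
    by rewrite !lt_neqAle x0 x1 eq_sym xn0 xn1.
  move=> /andP[x0 x1]; rewrite !ltW//; split => // -[x00|x11].
    by rewrite x00 ltxx in x0.
  by rewrite x11 ltxx in x1.
apply/eqP; rewrite eq_le measure_ge0 andbT.
have LU : (Lambda ([set 0%R] `|` [set 1%R]) <= Lambda [set 0%R] + Lambda [set 1%R])%E.
  exact: measureU2.
by rewrite Lambda_set0 L1 adde0 in LU.
Qed.

Lemma mu_negE (m : nat) : mu_neg Lambda m = (\int[Lambda]_(x in D) (x ^- m)%:E)%E.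
Proof.
rewrite /mu_neg integral_itvD; first last.
- exact: mu_neg_ge0.
- exact: measurable_mu_neg.
apply: eq_integral => x; rewrite inE /= in_itv /= => /andP[x0 _].
by rewrite gt_eqF.
Qed.

Lemma integrable_lam (k m : nat) : Lambda.-integrable D0
  (EFin \o (fun x : R => x ^+ k * (1 - x) ^+ m)).
Proof.
apply: measurable_bounded_integrable => //.
- by rewrite ltey_eq fin_num_measure.
- apply: measurable_funTS; apply: measurable_funM; apply: measurable_funX => //.
  by apply: measurable_funB => //; exact: measurable_cst.
- exists 1; split => // M M1 x /=; rewrite in_itv /= => /andP[x0 x1].
  have x10 : 0 <= 1 - x by rewrite subr_ge0.
  rewrite ger0_norm ?mulr_ge0 ?exprn_ge0// (le_trans _ (ltW M1))//.
  by rewrite -[leRHS]mulr1 ler_pM ?exprn_ge0// exprn_ile1// gerBl.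
Qed.

Lemma lamE (i k : nat) : (lam Lambda i k)%:E =
  (\int[Lambda]_(x in D) (x ^+ (k - 2) * (1 - x) ^+ (i - k))%:E)%E.
Proof.
rewrite /lam fineK; last exact: (integrable_fin_num _ (integrable_lam _ _)).
rewrite integral_itvD//.
- by have /integrableP[] := integrable_lam (k - 2) (i - k).
- move=> x /=; rewrite in_itv /= => /andP[x0 x1].
  by rewrite lee_fin mulr_ge0 ?exprn_ge0// subr_ge0.
Qed.

Lemma integrable_lamD (k m : nat) :
  Lambda.-integrable D (EFin \o (fun x : R => x ^+ k * (1 - x) ^+ m)).
Proof.
apply: integrableS (integrable_lam k m) => //.
by move=> x /=; rewrite !in_itv /= => /andP[/ltW-> /ltW->].
Qed.

Section SumLam.
Variables (I : finType) (Q : pred I) (i : nat) (k : I -> nat) (c : I -> R).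

Let F (S : I) (p : R) := p ^+ (k S - 2) * (1 - p) ^+ (i - k S).

Lemma integrable_sum_lam :
  Lambda.-integrable D (EFin \o (fun p => \sum_(S | Q S) F S p * c S)).
Proof.
have -> : EFin \o (fun p => \sum_(S | Q S) F S p * c S) =
    (fun p => \sum_(S | Q S) ((c S)%:E * (F S p)%:E)%E)%E.
  by apply/funext => p /=; rewrite -sumEFin; apply: eq_bigr => S _; rewrite -EFinM mulrC.
apply: integrable_sum => // S _; apply: integrableZl => //; exact: integrable_lamD.
Qed.

Lemma sum_lam_integral : (\sum_(S | Q S) lam Lambda i (k S) * c S)%:E =
  (\int[Lambda]_(p in D) (\sum_(S | Q S) F S p * c S)%:E)%E.
Proof.
have -> : (\int[Lambda]_(p in D) (\sum_(S | Q S) F S p * c S)%:E =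
    \int[Lambda]_(p in D) \sum_(S | Q S) ((c S)%:E * (F S p)%:E))%E.
  by apply: eq_integral => p _; rewrite -sumEFin; apply: eq_bigr => S _; rewrite -EFinM mulrC.
rewrite integral_sum//; last first.
  by move=> S; apply: integrableZl => //; exact: integrable_lamD.
rewrite -sumEFin; apply: eq_bigr => S _.
by rewrite integralZl//; [rewrite -lamE -EFinM mulrC|exact: integrable_lamD].
Qed.

End SumLam.

Lemma lam_sum_le (I : finType) (z : {set I}) (c : {set I} -> R) (h : R -> R) (C : R) :
  measurable_fun D h -> (forall p, D p -> 0 <= h p) ->
  (\int[Lambda]_(p in D) (h p)%:E <= C%:E)%E ->
  (forall p, 0 < p < 1 -> \sum_(S in powerset z | (2 <= #|S|)%N) bw z p S * c S
     <= p ^+ 2 * h p) ->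
  \sum_(S in powerset z | (2 <= #|S|)%N) lam Lambda #|z| #|S| * c S <= C.
Proof.
move=> mh h0 hC ch; rewrite -lee_fin; apply: le_trans (hC).
rewrite (@sum_lam_integral _ _ _ (fun S : {set I} => #|S|)).
apply: le_integral => //.
- exact: integrable_sum_lam.
- apply/integrableP; split; first exact/measurable_EFinP.
  rewrite (eq_integral (fun p => (h p)%:E)); first exact: le_lt_trans hC (ltry _).
  by move=> p; rewrite inE => Dp; rewrite gee0_abs// lee_fin h0.
- move=> p; rewrite inE /= in_itv /= => p01; have /andP[p0 p1] := p01.
  rewrite lee_fin -(ler_pM2l (exprn_gt0 2 p0)); apply: le_trans (ch p p01).
  rewrite mulr_sumr; apply: ler_sum => S /andP[_ S2].
  by rewrite !mulrA -exprD subnKC.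
Qed.

End LambdaIntegrals.

Section LambdaLimits.
Variables (R : realType) (Lambda : {finite_measure set R -> \bar R}).
Hypothesis L1 : Lambda [set 1%R] = 0%E.
Hypothesis mu1 : (mu_neg Lambda 1 < +oo)%E.

Local Notation D := (`]0%R, 1%R[%classic : set R).

Lemma measurable_min_ratio (eta : R) : measurable_fun D
  (fun p : R => p ^- 2 * Num.min 1 (eta * (p / (1 - p)))).
Proof.
apply: measurable_funM; first exact: measurable_invXD.
apply: measurable_minr => //; apply: measurable_funM => //.
apply: measurable_funM => //.
apply: open_continuous_measurable_fun; first exact: interval_open.
move=> x; rewrite inE /= in_itv /= => /andP[_ x1].
apply: cvgV; first by rewrite subr_eq0 gt_eqF.
by apply: cvgB; [exact: cvg_cst|exact: cvg_id].
Qed.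

Lemma min_ratio_ge0 (eta p : R) : 0 <= eta -> D p ->
  0 <= p ^- 2 * Num.min 1 (eta * (p / (1 - p))).
Proof.
move=> eta0; rewrite /= in_itv /= => /andP[p0 p1].
have p0' := ltW p0; have p1' := ltW p1.
by rewrite mulr_ge0 ?invr_ge0 ?exprn_ge0// le_min ler01 mulr_ge0// divr_ge0// subr_ge0.
Qed.

Lemma integral_min_ratio_small (e : R) : 0 < e -> exists2 eta : R, 0 < eta &
  (\int[Lambda]_(p in D) (p ^- 2 * Num.min 1 (eta * (p / (1 - p))))%:E <= e%:E)%E.
Proof.
move=> e0.
pose f (k : nat) (p : R) : \bar R :=
  (p ^- 2 * Num.min 1 (k.+1%:R^-1 * (p / (1 - p))))%:E.
pose g (p : R) : \bar R := (2%:E * (p ^- 1)%:E)%E.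
have ig : Lambda.-integrable D g.
  apply: integrableZl => //; apply/integrableP; split.
    by apply/measurable_EFinP; exact: measurable_invXD.
  rewrite (eq_integral (fun p : R => (p ^- 1)%:E)); first by rewrite -mu_negE.
  move=> p; rewrite inE /= in_itv /= => /andP[p0 _].
  by rewrite ger0_norm// invr_ge0 exprn_ge0// ltW.
have k0 (k : nat) : 0 <= k.+1%:R^-1 :> R by rewrite invr_ge0.
have mf k : measurable_fun D (f k).
  by apply/measurable_EFinP; exact: measurable_min_ratio.
have f0 : \forall p \ae Lambda, D p -> f k p @[k --> \oo] --> 0%E.
  apply: aeW => p Dp.
  have /= := Dp; rewrite in_itv /= => /andP[p0 p1].
  apply/fine_cvgP; split; first by apply: nearW.
  apply: (@squeeze_cvgr _ _ _ _ (fun=> 0) (fun k : nat => p ^- 2 * (p / (1 - p)) * k.+1%:R^-1)).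
  + apply: nearW => k; rewrite min_ratio_ge0//=.
    rewrite -[leRHS]mulrA ler_wpM2l ?invr_ge0 ?exprn_ge0 ?(ltW p0)//.
    by rewrite mulrC ge_min lexx orbT.
  + exact: cvg_cst.
  + rewrite -[X in _ --> X](mulr0 (p ^- 2 * (p / (1 - p)))).
    by apply: cvgMr; exact: cvg_harmonic.
have fg : \forall p \ae Lambda, forall k, D p -> (`|f k p| <= g p)%E.
  apply: aeW => p k Dp; have := Dp; rewrite /= in_itv /= => /andP[p0 p1].
  rewrite ger0_norm ?min_ratio_ge0// /g -EFinM lee_fin expr1.
  rewrite ler_pdivrMl ?exprn_gt0// (_ : p ^+ 2 * (2 / p) = 2 * p); last first.
    by field; rewrite gt_eqF.
  have [ph|ph] := leP p (2^-1); last by rewrite ge_min; apply/orP; left; lra.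
  rewrite ge_min; apply/orP; right.
  have -> : k.+1%:R^-1 * (p / (1 - p)) = p * (k.+1%:R^-1 * (1 - p)^-1) by ring.
  rewrite [leRHS]mulrC ler_wpM2l ?(ltW p0)// -[leRHS]mul1r ler_pM ?invr_ge0 ?subr_ge0 ?(ltW p1)//.
    by rewrite invf_le1 ?ler1n.
  by rewrite -[leRHS]invrK lef_pV2 ?posrE ?subr_gt0//; lra.
have [_ _] := dominated_convergence (measurable_itv _) mf (measurable_cst _) f0 ig fg.
rewrite integral_cst// mul0e => /fine_cvgP[fin /cvgrPdist_lt /(_ e e0) fe].
have [k [fink]] : exists k, (\int[Lambda]_(p in D) f k p)%E \is a fin_num /\
    `|0 - fine (\int[Lambda]_(p in D) f k p)%E| < e.
  by near \oo => k; exists k; split; near: k.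
rewrite sub0r normrN => /(le_lt_trans (ler_norm _)) ke.
exists k.+1%:R^-1; first by rewrite invr_gt0.
by rewrite -[leLHS]fineK// lee_fin ltW.
Unshelve. all: by end_near. Qed.

Lemma exit_rate_unbounded (A : R) : mu_neg Lambda 2 = +oo%E ->
  exists n, A <= \sum_(S in powerset (Defs.singletons n) | (2 <= #|S|)%N)
    lam Lambda #|Defs.singletons n| #|S|.
Proof.
move=> mu2.
pose g (k : nat) (p : R) := p ^- 2 * Num.max 0 (1 - 2 / (p * k.+1%:R)).
have g0 k p : D p -> 0 <= g k p.
  rewrite /= in_itv /= => /andP[p0 p1].
  by rewrite mulr_ge0 ?invr_ge0 ?exprn_ge0 ?le_max ?lexx// ltW.
have mg k : measurable_fun D (g k).
  apply: measurable_funM; first exact: measurable_invXD.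
  apply: measurable_maxr => //; apply: measurable_funB => //.
  rewrite (_ : (fun _ => _) = (fun p : R => (2 / k.+1%:R) * (p ^- 1))).
    by apply: measurable_funM => //; exact: measurable_invXD.
  by apply/funext => p; rewrite invfM expr1; ring.
have nd p : D p -> {homo (fun k => (g k p)%:E) : k l / (k <= l)%N >-> (k <= l)%E}.
  move=> Dp k l kl; have /= := Dp; rewrite in_itv /= => /andP[p0 p1].
  rewrite lee_fin ler_wpM2l ?invr_ge0 ?exprn_ge0 ?(ltW p0)//.
  rewrite ge_max le_max lexx /= le_max; apply/orP; right.
  rewrite lerB// ler_wpM2l// lef_pV2 ?posrE ?mulr_gt0//.
  by rewrite ler_wpM2l ?(ltW p0)// ler_nat.
have mg' k : measurable_fun D (fun p => (g k p)%:E) by exact/measurable_EFinP.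
have g0' k p : D p -> (0 <= (g k p)%:E)%E by move=> Dp; rewrite lee_fin g0.
have := cvg_monotone_convergence (mu := Lambda) (measurable_itv _) mg' g0' nd.
rewrite (eq_integral (fun p : R => (p ^- 2)%:E)); last first.
  move=> p; rewrite inE => Dp; have /= := Dp; rewrite in_itv /= => /andP[p0 p1].
  have p20 : 0 <= p ^- 2 by rewrite invr_ge0 exprn_ge0// ltW.
  apply/cvg_lim => //; apply/fine_cvgP; split; first exact: nearW.
  apply: (@squeeze_cvgr _ _ _ _
    (fun k : nat => p ^- 2 - p ^- 2 * (2 / p) * k.+1%:R^-1) (fun=> p ^- 2)).
  - apply: nearW => k /=; apply/andP; split.
      rewrite -mulrA -{1}[p ^- 2]mulr1 -mulrBr ler_wpM2l// le_max.
      by apply/orP; right; rewrite invfM mulrA.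
    rewrite -[leRHS]mulr1 ler_wpM2l// ge_max ler01 /= gerBl.
    by rewrite divr_ge0// mulr_ge0// ltW.
  - rewrite -[X in _ --> X]subr0 -[X in _ - X](mulr0 (p ^- 2 * (2 / p))).
    by apply: cvgB; [exact: cvg_cst|apply: cvgMr; exact: cvg_harmonic].
  - exact: cvg_cst.
rewrite -mu_negE// mu2 => /cvgeyPge /(_ A) H.
have {H} [k kA] : exists k : nat, (A%:E <= \int[Lambda]_(p in D) (g k p)%:E)%E.
  by near \oo => k; exists k; near: k.
exists k.+2; rewrite -lee_fin; apply: le_trans kA _.
have card_sing : #|Defs.singletons k.+2| = k.+2.
  by rewrite card_imset ?card_ord//; exact: set1_inj.
under eq_bigr do rewrite -[lam _ _ _]mulr1.
rewrite (@sum_lam_integral _ _ L1 mu1 _ _ _ (fun S : {set {set 'I_k.+2}} => #|S|) (fun=> 1)).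
apply: ge0_le_integral; [exact: measurable_itv|exact: g0'|exact: mg'| | ].
- by have /integrableP[] := integrable_sum_lam Lambda
    (fun S => (S \in powerset (Defs.singletons k.+2)) && (2 <= #|S|)%N)
    #|Defs.singletons k.+2| (fun S : {set {set 'I_k.+2}} => #|S|) (fun=> 1).
move=> p; rewrite /= in_itv /= => /andP[p0 p1]; rewrite lee_fin.
have p2 : 0 < p ^+ 2 by rewrite exprn_gt0.
rewrite ler_pdivrMl// mulr_sumr.
have -> : \sum_(S in powerset (Defs.singletons k.+2) | (1 < #|S|)%N)
    p ^+ 2 * (p ^+ (#|S| - 2) * (1 - p) ^+ (#|Defs.singletons k.+2| - #|S|) * 1) =
    \sum_(S in powerset (Defs.singletons k.+2) | (1 < #|S|)%N) bw (Defs.singletons k.+2) p S.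
  apply: eq_bigr => S /andP[_ S2].
  by rewrite mulr1 mulrA -exprD subnKC.
have p01 : 0 <= p <= 1 by rewrite !ltW.
rewrite ge_max; apply/andP; split.
  by apply: sumr_ge0 => S _; rewrite bw_ge0.
have := sum_bw (Defs.singletons k.+2) p.
rewrite (bigID (fun S : {set {set 'I_k.+2}} => (1 < #|S|)%N)) /=.
set s1 := \sum_(S in _ | (1 < _)%N) _; set s2 := \sum_(S in _ | _) _ => s12.
have -> : s1 = 1 - s2 by rewrite -s12 addrK.
rewrite lerD2l lerN2.
rewrite ler_pdivlMr ?mulr_gt0//.
have := sum_bw_card_lt2 (Defs.singletons k.+2) p01.
rewrite card_sing -[k.+2%:R]natr1 addrK mulrC /s2; apply: le_trans.
by under eq_bigl do rewrite -leqNgt -ltnS.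
Unshelve. all: by end_near. Qed.

End LambdaLimits.

(** * Law of large numbers for exchangeable events *)

Section LawOfLargeNumbers.
Variables (R : realType) (d : measure_display) (Omega : measurableType d).
Variables (P : probability Omega R) (Y : nat -> Omega -> bool) (a b : R).
Hypothesis mY : forall r, measurable [set w | Y r w].
Hypothesis Ya : forall r, pr P [set w | Y r w] = a.
Hypothesis Yb : forall r q, r != q -> pr P [set w | Y r w && Y q w] = b.

Definition mean k w : R := (\sum_(r < k) (Y r w)%:R) / k%:R.

Let F m w : {ffun 'I_m -> bool} := [ffun r : 'I_m => Y r w].

Let mF m : forall f, measurable [set w | F m w = f].
Proof. by apply: measurable_ffun => r. Qed.

Lemma pair_prob m (r q : 'I_m) :
  \sum_f pr P [set w | F m w = f] * (f r && f q)%:R = b + (r == q)%:R * (a - b).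
Proof.
transitivity (pr P [set w | Y r w && Y q w]).
  have -> : [set w | Y r w && Y q w] = [set w | (fun f : {ffun 'I_m -> bool} => f r && f q) (F m w)].
    by apply/seteqP; split => w /=; rewrite !ffunE.
  rewrite (pr_finE P (@mF m) (fun f => f r && f q)) [RHS]big_mkcond /=.
  by apply: eq_bigr => f _; case: (f r && f q); rewrite ?mulr1 ?mulr0.
have [->|rq] := eqVneq r q; last by rewrite Yb// mul0r addr0.
rewrite mul1r addrC subrK -(Ya q); congr (pr P _).
by apply/seteqP; split => w /=; rewrite andbb.
Qed.

Lemma second_moment m (c : 'I_m -> R) : \sum_r c r = 0 ->
  \sum_f pr P [set w | F m w = f] * (\sum_r c r * (f r)%:R) ^+ 2 =
  (a - b) * \sum_r c r ^+ 2.
Proof.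
move=> c0.
transitivity (\sum_r \sum_q c r * c q * (b + (r == q)%:R * (a - b))).
  under [RHS]eq_bigr do under eq_bigr do rewrite -pair_prob mulr_sumr.
  under [RHS]eq_bigr do rewrite exchange_big /=.
  rewrite [RHS]exchange_big /=; apply: eq_bigr => f _.
  rewrite expr2 big_distrl /= mulr_sumr; apply: eq_bigr => r _.
  rewrite big_distrr /= mulr_sumr; apply: eq_bigr => q _.
  by case: (f r); case: (f q) => /=; ring.
rewrite mulr_sumr; apply: etrans (_ : \sum_r (b * c r * \sum_q c q + (a - b) * c r ^+ 2) = _).
  apply: eq_bigr => r _.
  rewrite (eq_bigr (fun q => b * c r * c q + (r == q)%:R * ((a - b) * c r * c q))).
    rewrite big_split /= -mulr_sumr; congr (_ + _).
    rewrite (bigD1 r)//= eqxx mul1r big1 ?addr0; first by rewrite expr2 mulrA.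
    by move=> q qr; rewrite eq_sym (negbTE qr) mul0r.
  by move=> q _; ring.
by apply: eq_bigr => r _; rewrite c0 mulr0 add0r.
Qed.

Lemma mean_chebyshev k m e : (0 < k)%N -> (k <= m)%N -> 0 < e ->
  pr P [set w | e <= `|mean k w - mean m w|] <= (k%:R^-1 - m%:R^-1) / e ^+ 2 /\
  measurable [set w | e <= `|mean k w - mean m w|].
Proof.
move=> k0 km e0; have m0 : (0 < m)%N by exact: leq_trans km.
have kr : k%:R != 0 :> R by rewrite pnatr_eq0 -lt0n.
have mr : m%:R != 0 :> R by rewrite pnatr_eq0 -lt0n.
pose c (r : 'I_m) : R := (r < k)%:R / k%:R - m%:R^-1.
have sumk (x : R) : \sum_(r < m) (r < k)%:R * x = k%:R * x.
  rewrite -mulr_suml; congr (_ * _).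
  rewrite -[k in RHS]card_ord -sumr_const (big_ord_widen m (fun=> 1) km) [RHS]big_mkcond /=.
  by apply: eq_bigr => r _; case: ltnP.
have c0 : \sum_r c r = 0.
  by rewrite sumrB sumk sumr_const card_ord divff// -[_ *+ _]mulr_natr mulVf// subrr.
have c2 : \sum_r c r ^+ 2 = k%:R^-1 - m%:R^-1.
  rewrite (eq_bigr (fun r : 'I_m => (r < k)%:R * (k%:R^-1 ^+ 2 - 2 * k%:R^-1 * m%:R^-1) + m%:R^-1 ^+ 2)).
    rewrite big_split /= sumk sumr_const card_ord -[_ *+ _]mulr_natr.
    by field; rewrite kr mr.
  by move=> r _; rewrite /c; case: (r < k)%N => /=; ring.
pose G (f : {ffun 'I_m -> bool}) := \sum_r c r * (f r)%:R.
have GE w : mean k w - mean m w = G (F m w).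
  rewrite /mean /G (big_ord_widen m (fun r => (Y r w)%:R) km) big_mkcond /= !mulr_suml -sumrB.
  by apply: eq_bigr => r _; rewrite ffunE /c; case: (r < k)%N => /=; ring.
have -> : [set w | e <= `|mean k w - mean m w|] = [set w | (fun f => e <= `|G f|) (F m w)].
  by apply/seteqP; split => w /=; rewrite GE.
split; last exact: (measurable_fin (@mF m) (fun f => e <= `|G f|)).
apply: le_trans (markov_fin P (@mF m) (Q := fun f => e <= `|G f|) (f := fun f => (G f / e) ^+ 2) _ _) _.
- by move=> f; exact: sqr_ge0.
- move=> f ef; rewrite -real_normK ?num_real// -[leLHS](expr1n _ 2).
  rewrite lerXn2r ?nnegrE// normf_div [`|e|]gtr0_norm//.
  by rewrite ler_pdivlMr// mul1r.
- rewrite (eq_bigr (fun f => pr P [set w | F m w = f] * G f ^+ 2 * e ^- 2)); last first.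
    by move=> f _; rewrite expr_div_n mulrA.
  rewrite -mulr_suml second_moment// c2 ler_wpM2r ?invr_ge0 ?exprn_ge0 ?(ltW e0)//.
  rewrite -[leRHS]mul1r ler_wpM2r//.
    by rewrite subr_ge0 lef_pV2 ?posrE ?ltr0n// ler_nat.
  have b0 : 0 <= b by rewrite -(@Yb 0 1)// pr_ge0.
  have a1 : a <= 1 by rewrite -(Ya 0) -(pr_setT P); apply: le_pr.
  by lra.
Qed.

Lemma mean_lipschitz k l w : (0 < l)%N -> (l <= k)%N ->
  `|mean k w - mean l w| <= 2 * (k%:R - l%:R) / l%:R.
Proof.
move=> l0 lk; have k0 : (0 < k)%N by exact: leq_trans lk.
have lr : 0 < l%:R :> R by rewrite ltr0n.
have kr : 0 < k%:R :> R by rewrite ltr0n.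
have lkr : l%:R <= k%:R :> R by rewrite ler_nat.
pose S k : R := \sum_(r < k) (Y r w)%:R.
have SE j : S j <= j%:R.
  rewrite /S -[j in leRHS]card_ord -sumr_const.
  by apply: ler_sum => r _; case: (Y r w).
have S0 j : 0 <= S j by apply: sumr_ge0.
have : S l <= S k <= S l + (k%:R - l%:R).
  rewrite -(subnKC lk); move: (k - l)%N => e; elim: e => [|e /andP[IH1 IH2]].
    by rewrite addn0 subrr addr0 lexx.
  have SS : S (l + e).+1 = S (l + e)%N + (Y (l + e)%N w)%:R by rewrite /S big_ord_recr.
  rewrite addnS SS -[(l + e).+1%:R]natr1.
  by case: (Y _ w) => /=; apply/andP; split; lra.
move=> /andP[S1 S2]; have Sl := SE l; have Sl0 := S0 l.
rewrite /mean -/(S k) -/(S l) ler_pdivlMr// -[X in _ * X]gtr0_norm// -normrM.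
rewrite mulrBl divfK ?gt_eqF//.
have -> : S k / k%:R * l%:R - S l = ((S k - S l) * l%:R - S l * (k%:R - l%:R)) / k%:R.
  by field; rewrite gt_eqF.
rewrite normf_div [`|k%:R|]gtr0_norm// ler_pdivrMr//.
apply: le_trans (ler_normB _ _) _; rewrite ![X in X + _]ger0_norm ?mulr_ge0 ?subr_ge0 ?(ltW lr)//.
rewrite ger0_norm ?mulr_ge0 ?subr_ge0//.
have A1 : (S k - S l) * l%:R <= (k%:R - l%:R) * k%:R by apply: ler_pM; lra.
have A2 : S l * (k%:R - l%:R) <= k%:R * (k%:R - l%:R) by apply: ler_wpM2r; lra.
by lra.
Qed.

Let pow5 j := (j.+1 ^ 5)%N.

Lemma pow5_gap j : (pow5 j.+1)%:R - (pow5 j)%:R <= 31 * j.+1%:R ^+ 4 :> R.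
Proof.
rewrite /pow5 !natrX -[j.+2%:R]natr1; set x := j.+1%:R.
have x1 : 1 <= x by rewrite /x ler1n.
have x2 : x <= x ^+ 2 by rewrite expr2 ler_peMl//; lra.
have x3 : x ^+ 2 <= x ^+ 3 by rewrite [leRHS]exprS ler_peMl//; lra.
have x4 : x ^+ 3 <= x ^+ 4 by rewrite [leRHS]exprS ler_peMl//; lra.
have -> : (x + 1) ^+ 5 - x ^+ 5 = 5 * x ^+ 4 + 10 * x ^+ 3 + 10 * x ^+ 2 + 5 * x + 1 by ring.
by lra.
Qed.

Lemma pow5_gt0 j : (0 < pow5 j)%N. Proof. by rewrite expn_gt0. Qed.

Lemma leq_pow5 i j : (i <= j)%N -> (pow5 i <= pow5 j)%N.
Proof. by move=> ij; rewrite leq_exp2r. Qed.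

Let jump j := [set w | (j.+1%:R ^+ 2)^-1 <= `|mean (pow5 j) w - mean (pow5 j.+1) w|].

Lemma measurable_jump j : measurable (jump j).
Proof.
by have [] := @mean_chebyshev (pow5 j) (pow5 j.+1) (j.+1%:R ^+ 2)^-1 (pow5_gt0 j)
  (leq_pow5 (leqnSn j)); rewrite ?invr_gt0 ?exprn_gt0.
Qed.

Lemma pr_jump_le j : pr P (jump j) <= 31 * (j.+1%:R ^+ 2)^-1.
Proof.
have [|+ _] := @mean_chebyshev (pow5 j) (pow5 j.+1) (j.+1%:R ^+ 2)^-1 (pow5_gt0 j)
  (leq_pow5 (leqnSn j)); rewrite ?invr_gt0 ?exprn_gt0//.
move/le_trans; apply.
have gap := pow5_gap j.
have k0 : 0 < (pow5 j)%:R :> R by rewrite ltr0n pow5_gt0.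
have km : (pow5 j)%:R <= (pow5 j.+1)%:R :> R by rewrite ler_nat leq_pow5.
have m0 : 0 < (pow5 j.+1)%:R :> R by exact: lt_le_trans km.
have -> : (pow5 j)%:R^-1 - (pow5 j.+1)%:R^-1 =
    ((pow5 j.+1)%:R - (pow5 j)%:R) / ((pow5 j)%:R * (pow5 j.+1)%:R) :> R.
  by field; rewrite !gt_eqF.
have x0 : 0 < j.+1%:R :> R by [].
apply: (@le_trans _ _ (31 * j.+1%:R ^+ 4 / ((pow5 j)%:R * (pow5 j)%:R) / ((j.+1%:R ^+ 2)^-1) ^+ 2)).
  rewrite ler_wpM2r ?invr_ge0 ?exprn_ge0 ?invr_ge0//.
  rewrite ler_pM// ?subr_ge0// ?invr_ge0 ?mulr_ge0// ?(ltW k0) ?(ltW m0)//.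
  by rewrite lef_pV2 ?posrE ?mulr_gt0// ler_wpM2l// ltW.
rewrite /pow5 !natrX le_eqVlt; apply/orP; left; apply/eqP.
by field; rewrite gt_eqF.
Qed.

Lemma sum_pr_jump : (\sum_(0 <= j <oo) P (jump j) < +oo)%E.
Proof.
apply: (@le_lt_trans _ _ (62%:E)); last exact: ltry.
apply: lime_le; first exact: is_cvg_nneseries.
apply: nearW => n.
have bnd : \sum_(0 <= j < n.+1) (j.+1%:R ^+ 2)^-1 <= 2 - n.+1%:R^-1 :> R.
  elim: n => [|n IH]; first by rewrite big_nat1 expr1n invr1; lra.
  rewrite big_nat_recr//=; apply: le_trans (lerD IH (lexx _)) _.
  rewrite -[n.+2%:R]natr1; set x := n.+1%:R : R.
  have x0 : 0 < x by rewrite /x.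
  have -> : 2 - x^-1 + ((x + 1) ^+ 2)^-1 = 2 - (x + 1)^-1 - (x * (x + 1) ^+ 2)^-1.
    by field; rewrite !gt_eqF// addr_gt0.
  by rewrite gerBl invr_ge0 mulr_ge0 ?exprn_ge0 ?addr_ge0 ?ltW.
apply: (@le_trans _ _ (\sum_(0 <= j < n) (31 * (j.+1%:R ^+ 2)^-1)%:E)%E).
  apply: lee_sum => j _; have := pr_jump_le j; rewrite -lee_fin.
  by apply: le_trans; rewrite -(pr_fin P (measurable_jump j)).
rewrite sumEFin lee_fin -mulr_sumr (_ : 62 = 31 * 2); last by ring.
rewrite ler_wpM2l//; apply: (@le_trans _ _ (\sum_(0 <= j < n.+1) (j.+1%:R ^+ 2)^-1)).
  by rewrite [leRHS]big_nat_recr//= lerDl invr_ge0 exprn_ge0.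
by apply: le_trans bnd _; rewrite gerBl invr_ge0.
Qed.

Lemma mean_pow5_cauchy w J : (forall j, (J <= j)%N -> ~ jump j w) ->
  forall i j, (J <= i.+1)%N -> (i <= j)%N ->
  `|mean (pow5 j.+1) w - mean (pow5 i.+1) w| <= i.+1%:R^-1 - j.+1%:R^-1.
Proof.
move=> JE i j Ji ij; rewrite -(subnKC ij); elim: (j - i)%N => [|e IH].
  by rewrite addn0 !subrr normr0.
rewrite addnS; set k := (i + e)%N in IH *.
have /JE/negP : (J <= k.+1)%N by apply: leq_trans Ji _; rewrite ltnS leq_addr.
rewrite -ltNge => Ek.
have -> : mean (pow5 k.+2) w - mean (pow5 i.+1) w =
    - (mean (pow5 k.+1) w - mean (pow5 k.+2) w) + (mean (pow5 k.+1) w - mean (pow5 i.+1) w) by ring.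
apply: le_trans (ler_normD _ _) _; rewrite normrN.
apply: le_trans (lerD (ltW Ek) IH) _.
rewrite -[k.+2%:R]natr1; set x := k.+1%:R : R.
have x0 : 0 < x by rewrite /x.
have -> : (((x + 1) ^+ 2)^-1 + (i.+1%:R^-1 - x^-1)) =
    i.+1%:R^-1 - (x + 1)^-1 - (x * (x + 1) ^+ 2)^-1 :> R.
  by field; rewrite !gt_eqF// addr_gt0.
by rewrite gerBl invr_ge0 mulr_ge0 ?exprn_ge0 ?addr_ge0 ?ltW.
Qed.

Lemma ae_cvg_mean : {ae P, forall w, cvgn (mean^~ w)}.
Proof.
have N0 : P.-negligible (lim_sup_set jump).
  apply/negligibleP; last exact: (lim_sup_set_cvg0 measurable_jump sum_pr_jump).
  by apply: bigcapT_measurable => n; apply: bigcup_measurable => j _; exact: measurable_jump.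
apply: negligibleS N0 => w /=; apply: contra_notP => nE.
have [J JE] : exists J, forall j, (J <= j)%N -> ~ jump j w.
  apply: contrapT => /forallNP H; apply: nE => n _.
  apply: contrapT => nn; apply: (H n) => j nj Ej; apply: nn.
  by exists j.
apply/cauchy_cvgP/cauchy_exP => e e0.
pose i := (maxn J (Num.truncn (63 / e)))%N.
have Ji : (J <= i.+1)%N by rewrite ltnW// ltnS leq_maxl.
have ie : 63 * i.+1%:R^-1 < e.
  rewrite ltr_pdivrMr// mulrC -ltr_pdivrMr//.
  apply: lt_le_trans (truncnS_gt _) _.
  by rewrite ler_nat ltnS leq_maxr.
exists (mean (pow5 i.+1) w); exists (pow5 i.+1) => // k /= ik.
have [j ij /andP[jk kj]] : exists2 j, (i <= j)%N & (pow5 j.+1 <= k < pow5 j.+2)%N.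
  have exP : exists j, (i <= j)%N && (pow5 j.+1 <= k)%N by exists i; rewrite leqnn.
  have bP : forall j, (i <= j)%N && (pow5 j.+1 <= k)%N -> (j <= k)%N.
    move=> j /andP[_]; apply: leq_trans; rewrite /pow5.
    by apply: (@leq_trans (j.+2 ^ 1)%N); [rewrite expn1; lia|rewrite leq_exp2l].
  have [j /andP[ij jk] maxj] := ex_maxnP exP bP; exists j => //.
  rewrite jk ltnNge; apply/negP => kj.
  by have := maxj j.+1; rewrite kj (leq_trans ij)// => /(_ erefl); rewrite ltnn.
rewrite /ball /= distrC.
have -> : mean k w - mean (pow5 i.+1) w =
  (mean k w - mean (pow5 j.+1) w) + (mean (pow5 j.+1) w - mean (pow5 i.+1) w) by ring.
apply: le_lt_trans (ler_normD _ _) _; apply: le_lt_trans ie.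
have -> : 63 * i.+1%:R^-1 = 62 * i.+1%:R^-1 + i.+1%:R^-1 :> R by ring.
apply: lerD; last first.
  apply: le_trans (mean_pow5_cauchy JE Ji ij) _.
  by rewrite gerBl invr_ge0.
apply: le_trans (mean_lipschitz _ (pow5_gt0 _) jk) _.
apply: (@le_trans _ _ (62 * j.+2%:R^-1)); last first.
  by rewrite ler_wpM2l// lef_pV2 ?posrE// ler_nat; lia.
have gap := pow5_gap j.+1.
have kk : k%:R <= (pow5 j.+2)%:R :> R by rewrite ler_nat ltnW.
rewrite ler_pdivrMr ?ltr0n ?pow5_gt0//.
have -> : 62 * j.+2%:R^-1 * (pow5 j.+1)%:R = 2 * (31 * j.+2%:R ^+ 4) :> R.
  by rewrite /pow5 natrX; field; rewrite gt_eqF.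
by lra.
Qed.

End LawOfLargeNumbers.

(** * Drift of the number of non-singleton blocks *)

Section NonSingletonBlocks.
Import mathcomp.boot.fintype mathcomp.boot.finset.

Definition nsb n m (x : {set {set 'I_n}}) : {set {set 'I_n}} :=
  [set b in x | (2 <= #|[set i in b | (i < m)%N]|)%N]%SET.

Lemma nsb_sub n m (x : {set {set 'I_n}}) : nsb m x \subset x.
Proof. by apply/subsetP => b; rewrite inE => /andP[]. Qed.

Lemma nsb_subS n m m' (x : {set {set 'I_n}}) : (m <= m')%N -> nsb m x \subset nsb m' x.
Proof.
move=> mm'; apply/subsetP => b; rewrite !inE => /andP[-> b2] /=.
apply: leq_trans b2 _; apply: subset_leq_card; apply/subsetP => i.
by rewrite !inE => /andP[-> /leq_trans->].
Qed.

Lemma mem_nsb_restr n m (E : nat -> nat -> bool) (i j k : nat) (ilt : (i < n)%N) :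
  (m <= n)%N -> (j < m)%N -> (k < m)%N -> j != k -> E i j -> E i k ->
  [set l : 'I_n | E i l]%SET \in nsb m (restr n E).
Proof.
move=> mn jm km jk Eij Eik.
have jn : (j < n)%N by exact: leq_trans mn. have kn : (k < n)%N by exact: leq_trans mn.
rewrite inE; apply/andP; split; first by apply/imsetP; exists (Ordinal ilt).
apply: (@leq_trans #|[set Ordinal jn; Ordinal kn]|).
  by rewrite cards2 -val_eqE /= jk.
apply: subset_leq_card; apply/subsetP => l; rewrite !inE.
by case/orP => /eqP ->; rewrite /= ?Eij ?Eik.
Qed.

Lemma nsb_restrP n m (E : nat -> nat -> bool) (b : {set 'I_n}) :
  Defs.equiv_rel E -> b \in nsb m (restr n E) ->
  exists i j : 'I_n, [/\ (i < m)%N, (j < m)%N, i != j, E i j &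
    b = [set l : 'I_n | E i l]%SET].
Proof.
move=> [refl [sym tr]]; rewrite inE => /andP[/imsetP[k _ bE]].
move=> /card_gt1P[i [j [+ + ij]]]; rewrite bE !inE => /andP[ki im] /andP[kj jm].
exists i, j; split => //; first exact: tr (sym _ _ ki) kj.
apply/setP => l; rewrite !inE; apply/idP/idP => [kl|il].
  exact: tr (sym _ _ ki) kl.
exact: tr ki il.
Qed.

Lemma leq_nsb_restr n m (E : nat -> nat -> bool) : (m <= n)%N -> Defs.equiv_rel E ->
  (#|nsb m (restr m E)| <= #|nsb m (restr n E)|)%N.
Proof.
move=> mn eqE.
pose r (b : {set 'I_n}) : {set 'I_m} := [set l : 'I_m | widen_ord mn l \in b]%SET.
apply: leq_trans (leq_imset_card r _); apply: subset_leq_card.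
apply/subsetP => b /(nsb_restrP eqE)[i [j [im jm ij Eij ->]]].
have iltn : (i < n)%N by exact: leq_trans im mn.
apply/imsetP; exists [set l : 'I_n | E i l]%SET.
  by apply: (@mem_nsb_restr n m E i i j) => //; have [refl _] := eqE.
by apply/setP => l; rewrite !inE.
Qed.

Lemma leq_nsb n m (E : nat -> nat -> bool) : (m <= n)%N -> Defs.equiv_rel E ->
  (#|nsb m (restr m E)| <= #|nsb n (restr n E)|)%N.
Proof.
move=> mn eqE; apply: leq_trans (leq_nsb_restr mn eqE) _.
exact/subset_leq_card/nsb_subS.
Qed.

Lemma nsb_singletons n m : nsb m (Defs.singletons n) = set0.
Proof.
apply/setP => b; rewrite !inE; apply/negP => /andP[/imsetP[i _ ->]].
move=> /card_gt1P[j [k [+ + jk]]]; rewrite !inE => /andP[/eqP ji _] /andP[/eqP ki _].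
by rewrite ji ki eqxx in jk.
Qed.

Lemma nsb_restr_eq0 n (E : nat -> nat -> bool) : Defs.equiv_rel E ->
  #|nsb n (restr n E)| = 0%N -> restr n E = Defs.singletons n.
Proof.
move=> eqE /cards0_eq nsb0; apply: eq_imset => i; apply/setP => j; rewrite !inE.
have [-> |ji] := eqVneq j i; first by have [->] := eqE.
apply/negP => Eij.
have := @mem_nsb_restr n n E i i j (ltn_ord i) (leqnn n) (ltn_ord i) (ltn_ord j).
rewrite nsb0 inE => H; suff : false by [].
by apply: H => //; [rewrite eq_sym|have [refl _] := eqE].
Qed.

Lemma nsb_merge n m (z S : {set {set 'I_n}}) :
  (#|nsb m (Defs.merge z S)| <= #|nsb m z|.+1)%N.
Proof.
apply: (@leq_trans #|cover S |: nsb m z|).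
  apply: subset_leq_card; apply/subsetP => b; rewrite !inE.
  by case/andP => /orP[/andP[_ ->] ->|-> _]; rewrite ?orbT.
by rewrite cardsU1; case: (_ \notin _).
Qed.

Lemma card_survivors n (A z S : {set {set 'I_n}}) :
  (#|(A :&: z) :\: S| <= #|A :&: Defs.merge z S|)%N.
Proof.
apply: subset_leq_card; apply/subsetP => b; rewrite !inE.
by case/andP => -> /andP[-> ->].
Qed.

End NonSingletonBlocks.

Section Drift.
Variables (R : realType) (Lambda : {finite_measure set R -> \bar R}).
Hypothesis L1 : Lambda [set 1%R] = 0%E.
Hypothesis mu1 : (mu_neg Lambda 1 < +oo)%E.

Local Notation D := (`]0%R, 1%R[%classic : set R).
Local Notation mu := (fine (mu_neg Lambda 1)).

Lemma mu_ge0 : 0 <= mu.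
Proof.
rewrite fine_ge0// mu_negE//; apply: integral_ge0 => p /=.
by rewrite in_itv /= => /andP[p0 _]; rewrite lee_fin invr_ge0 exprn_ge0// ltW.
Qed.

Lemma mu_fin : mu_neg Lambda 1 = mu%:E.
Proof.
rewrite fineK// ge0_fin_numE// mu_negE//; apply: integral_ge0 => p /=.
by rewrite in_itv /= => /andP[p0 _]; rewrite lee_fin invr_ge0 exprn_ge0// ltW.
Qed.

Lemma drift_le n (A z : {set {set 'I_n}}) (phi : nat -> R) (h : R -> R) (C : R) :
  (forall u v, (u <= v)%N -> phi v <= phi u) ->
  measurable_fun D h -> (forall p, D p -> 0 <= h p) ->
  (\int[Lambda]_(p in D) (h p)%:E <= C%:E)%E ->
  (forall p, 0 < p < 1 -> \sum_(S in powerset z) bw z p S *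
     (phi #|((A :&: z) :\: S)%SET| - phi #|(A :&: z)%SET|) <= p ^+ 2 * h p) ->
  \sum_(S in powerset z | (2 <= #|S|)%N) lam Lambda #|z| #|S| *
     (phi #|(A :&: Defs.merge z S)%SET| - phi #|(A :&: z)%SET|) <= C.
Proof.
move=> nphi mh h0 hC H.
apply: (@le_trans _ _ (\sum_(S in powerset z | (2 <= #|S|)%N) lam Lambda #|z| #|S| *
     (phi #|((A :&: z) :\: S)%SET| - phi #|(A :&: z)%SET|))).
  apply: ler_sum => S _; rewrite ler_wpM2l ?lam_ge0// lerB//.
  by apply: nphi; exact: card_survivors.
apply: (lam_sum_le L1 mu1 mh h0 hC) => p p01; apply: le_trans (H p p01).
rewrite [leRHS](bigID (fun S : {set {set 'I_n}} => (2 <= #|S|)%N)) /= lerDl.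
have /andP[p0 p1] := p01.
apply: sumr_ge0 => S _; rewrite mulr_ge0 ?bw_ge0 ?(ltW p0) ?(ltW p1)// subr_ge0.
by apply: nphi; apply: subset_leq_card; exact: finset.subsetDl.
Qed.

Lemma drift_indic n (A z : {set {set 'I_n}}) (k : nat) :
  \sum_(S in powerset z | (2 <= #|S|)%N) lam Lambda #|z| #|S| *
     ((#|(A :&: Defs.merge z S)%SET| < k)%:R - (#|(A :&: z)%SET| < k)%:R) <= k%:R * mu.
Proof.
apply: (@drift_le n A z (fun u => (u < k)%:R) (fun p => k%:R * p ^- 1)).
- by move=> u v uv; rewrite ler_nat; case: (ltnP v k) => // vk; rewrite (leq_ltn_trans uv vk).
- by apply: measurable_funM => //; exact: measurable_invXD.
- move=> p /=; rewrite in_itv /= => /andP[p0 _].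
  by rewrite mulr_ge0// invr_ge0 exprn_ge0// ltW.
- under eq_integral do rewrite EFinM.
  rewrite ge0_integralZl//.
  + by rewrite -mu_negE// mu_fin// -EFinM.
  + by apply/measurable_EFinP; exact: measurable_invXD.
  + by move=> p /=; rewrite in_itv /= => /andP[p0 _]; rewrite lee_fin invr_ge0 exprn_ge0// ltW.
- move=> p /andP[p0 p1].
  set B := (A :&: z)%SET; have Bz : B \subset z by exact: finset.subsetIr.
  have -> : p ^+ 2 * (k%:R * p ^- 1) = k%:R * p by rewrite expr1; field; rewrite gt_eqF.
  apply: (@le_trans _ _ (k%:R / #|B|%:R * (p * #|B|%:R))); last first.
    have [->|B0] := eqVneq #|B| 0%N; first by rewrite invr0 mulr0 mul0r mulr_ge0// ltW.
    rewrite le_eqVlt; apply/orP; left; apply/eqP; field.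
    by rewrite pnatr_eq0.
  rewrite -(sum_bw_cardI _ Bz) mulr_sumr; apply: ler_sum => S _.
  rewrite [leRHS]mulrCA ler_wpM2l ?bw_ge0 ?(ltW p0) ?(ltW p1)//.
  have [Bk|kB] := ltnP #|B| k.
    rewrite (leq_ltn_trans _ Bk) ?subrr ?mulr_ge0 ?divr_ge0//.
    by apply: subset_leq_card; exact: finset.subsetDl.
  rewrite subr0 cardsD; have [Bk'|_] := ltnP _ k; last by rewrite mulr_ge0 ?divr_ge0.
  have B0 : (0 < #|B|)%N.
    rewrite lt0n; apply/negP => /eqP B0; rewrite B0 in kB Bk'.
    by rewrite leqn0 in kB; rewrite (eqP kB) in Bk'.
  rewrite mulrAC ler_pdivlMr ?ltr0n// mul1r -natrM ler_nat.
  set u := #|B| in kB Bk' B0 *; set j := #|(B :&: S)%SET| in Bk' *.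
  by nia.
Qed.

Lemma drift_one n (z : {set {set 'I_n}}) (c : {set {set 'I_n}} -> R) :
  (mu_neg Lambda 2 < +oo)%E -> (forall S, c S <= 1) ->
  \sum_(S in powerset z | (2 <= #|S|)%N) lam Lambda #|z| #|S| * c S
    <= fine (mu_neg Lambda 2).
Proof.
move=> mu2 c1.
have mu20 : (0 <= mu_neg Lambda 2)%E.
  rewrite mu_negE//; apply: integral_ge0 => p /=.
  by rewrite in_itv /= => /andP[p0 _]; rewrite lee_fin invr_ge0 exprn_ge0// ltW.
apply: (@lam_sum_le R Lambda L1 mu1 _ z c (fun p => p ^- 2)).
- exact: measurable_invXD.
- by move=> p /=; rewrite in_itv /= => /andP[p0 _]; rewrite invr_ge0 exprn_ge0// ltW.
- by rewrite fineK ?ge0_fin_numE// mu_negE.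
- move=> p /andP[p0 p1]; rewrite divff ?expf_neq0 ?gt_eqF// -[leRHS](sum_bw z p).
  rewrite [leRHS](bigID (fun S : {set {set 'I_n}} => (2 <= #|S|)%N)) /= -[leLHS]addr0.
  have p01 : 0 <= p <= 1 by rewrite !ltW.
  apply: lerD; last by apply: sumr_ge0 => S _; exact: bw_ge0.
  by apply: ler_sum => S _; rewrite ler_piMr ?bw_ge0.
Qed.

End Drift.

(** * Survival of blocks *)

Section Lyapunov.
Variable R : realType.

Definition hsum (u : nat) : R := series (@harmonic R) u.

(* The logarithmic scale of [hsum] makes the expected increase of [lyap] under
   removal of a binomial number of elements uniformly small, even for
   success probabilities close to [1]. *)
Definition lyap (k : nat) (eta : R) (u : nat) : R :=
  Num.max 0 (Num.min 1 (1 + eta * hsum k - eta * hsum u)).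

Lemma hsumS u : hsum u.+1 = hsum u + u.+1%:R^-1.
Proof. by rewrite /hsum /series /= big_nat_recr. Qed.

Lemma hsum_diff u v : (v <= u)%N ->
  0 <= hsum u - hsum v <= (u - v)%N%:R / v.+1%:R.
Proof.
move=> vu; rewrite -{1 2}(subnKC vu); elim: (u - v)%N => [|e /andP[IH1 IH2]].
  by rewrite addn0 subrr mul0r lexx.
rewrite addnS hsumS -[e.+1%:R]natr1 mulrDl mul1r.
have p0 : 0 <= (v + e).+1%:R^-1 :> R by rewrite invr_ge0.
have p1 : (v + e).+1%:R^-1 <= v.+1%:R^-1 :> R.
  by rewrite lef_pV2 ?posrE// ler_nat ltnS leq_addr.
by rewrite addrAC addr_ge0//= lerD.
Qed.

Lemma hsum_unbounded (A : R) : exists M, forall u, (M <= u)%N -> A <= hsum u.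
Proof.
have nd : nondecreasing_seq (series (@harmonic R)).
  move=> u v uv; have /andP[+ _] := hsum_diff uv.
  by rewrite subr_ge0.
have /cvgryPge/(_ A)[M _ HM] := nondecreasing_dvgn_lt nd (@dvg_harmonic R).
by exists M => u /HM.
Qed.

Section LyapunovBounds.
Variables (k : nat) (eta : R).
Hypothesis eta0 : 0 < eta.

Lemma lyap_ge0 u : 0 <= lyap k eta u.
Proof. by rewrite /lyap le_max lexx. Qed.

Lemma lyap_le1 u : lyap k eta u <= 1.
Proof. by rewrite /lyap ge_max ler01 /= ge_min lexx. Qed.

Lemma lyap_diff u v : (v <= u)%N -> 0 <= lyap k eta v - lyap k eta u <=
  Num.min 1 (eta * ((u - v)%N%:R / v.+1%:R)).
Proof.
move=> vu; have /andP[H0 H1] := hsum_diff vu.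
have H2 : 0 <= eta * (hsum u - hsum v) by rewrite mulr_ge0// ltW.
have H3 := ler_wpM2l (ltW eta0) H1.
have clipP (x : R) : [\/ x <= 0 /\ Num.max 0 (Num.min 1 x) = 0,
    0 <= x <= 1 /\ Num.max 0 (Num.min 1 x) = x | 1 <= x /\ Num.max 0 (Num.min 1 x) = 1].
  have [x1|x1] := leP 1 x; first by constructor 3; rewrite max_r// ler01.
  have [x0|x0] := leP 0 x; first by constructor 2; rewrite ltW.
  by constructor 1; rewrite ltW.
rewrite le_min /lyap; move: H2 H3; rewrite mulrBr.
set e := eta * (_ / _); set x := 1 + _ - eta * hsum u; set y := 1 + _ - eta * hsum v => H2 H3.
have xy : x <= y by rewrite lerD2l lerN2 -subr_ge0.
have yx : y <= x + e by rewrite /x /y; lra.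
by case: (clipP x) => -[? ->]; case: (clipP y) => -[? ->];
  apply/andP; split; try (apply/andP; split); lra.
Qed.

Lemma lyap_nincr u v : (v <= u)%N -> lyap k eta u <= lyap k eta v.
Proof. by move=> /lyap_diff /andP[+ _]; rewrite subr_ge0. Qed.

Lemma lyap_small u : (u <= k)%N -> lyap k eta u = 1.
Proof.
move=> uk; have /andP[H _] := hsum_diff uk.
have H2 : 0 <= eta * (hsum k - hsum u) by rewrite mulr_ge0// ltW.
rewrite /lyap (_ : Num.min _ _ = 1); first by rewrite max_r// ler01.
by apply: min_l; rewrite -addrA -mulrBr lerDl.
Qed.

Lemma lyap_large : exists M, forall u, (M <= u)%N -> lyap k eta u = 0.
Proof.
have [M HM] := hsum_unbounded ((1 + eta * hsum k) / eta); exists M => u /HM.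
rewrite ler_pdivrMr// => H; apply: max_l.
by rewrite ge_min; apply/orP; right; rewrite subr_le0 [leRHS]mulrC.
Qed.

End LyapunovBounds.
End Lyapunov.

Section Survival.
Variables (R : realType) (Lambda : {finite_measure set R -> \bar R}).
Hypothesis L1 : Lambda [set 1%R] = 0%E.
Hypothesis mu1 : (mu_neg Lambda 1 < +oo)%E.
Local Notation D := (`]0%R, 1%R[%classic : set R).
Local Notation mu := (fine (mu_neg Lambda 1)).

Lemma drift_lyap n (A z : {set {set 'I_n}}) (k : nat) (eta C : R) : 0 < eta ->
  (\int[Lambda]_(p in D) (p ^- 2 * Num.min 1 (eta * (p / (1 - p))))%:E <= C%:E)%E ->
  \sum_(S in powerset z | (2 <= #|S|)%N) lam Lambda #|z| #|S| *
     (lyap k eta #|(A :&: Defs.merge z S)%SET| - lyap k eta #|(A :&: z)%SET|) <= C.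
Proof.
move=> eta0 hC.
apply: (drift_le L1 mu1 _ _ _ hC).
- by move=> u v; exact: lyap_nincr.
- exact: measurable_min_ratio.
- by move=> p Dp; apply: min_ratio_ge0 => //; exact: ltW.
move=> p p01; have /andP[p0 p1] := p01.
have p01' : 0 <= p <= 1 by rewrite !ltW.
set B := (A :&: z)%SET; have Bz : B \subset z by exact: finset.subsetIr.
rewrite mulVKf ?expf_neq0 ?gt_eqF// le_min.
have bnd S : lyap k eta #|(B :\: S)%SET| - lyap k eta #|B| <=
    Num.min 1 (eta * (#|(B :&: S)%SET|%:R / #|(B :\: S)%SET|.+1%:R)).
  have BS : (#|(B :\: S)%SET| <= #|B|)%N.
    by apply: subset_leq_card; exact: finset.subsetDl.
  have /andP[_] := lyap_diff k eta0 BS.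
  have -> // : (#|B| - #|(B :\: S)%SET| = #|(B :&: S)%SET|)%N.
  by rewrite -(cardsID S B) addnK.
apply/andP; split.
  rewrite -[leRHS](sum_bw z p); apply: ler_sum => S _.
  rewrite ler_piMr ?bw_ge0//; apply: le_trans (bnd S) _.
  by rewrite ge_min lexx.
apply: (@le_trans _ _ (\sum_(S in powerset z)
    eta * (bw z p S * (#|(B :&: S)%SET|%:R / #|(B :\: S)%SET|.+1%:R)))).
  apply: ler_sum => S _; rewrite [leRHS]mulrCA ler_wpM2l ?bw_ge0//.
  by apply: le_trans (bnd S) _; rewrite ge_min lexx orbT.
rewrite -mulr_sumr ler_wpM2l ?(ltW eta0)//.
by apply: sum_bw_ratio; rewrite ?(ltW p0).
Qed.

Variables (d : measure_display) (Omega : measurableType d) (P : probability Omega R).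
Variable Pi : R -> Omega -> nat -> nat -> bool.
Hypothesis coal : is_Lambda_coalescent Lambda P Pi.

Section SurvivalSmall.
Variables (n : nat) (A : {set {set 'I_n}} -> {set {set 'I_n}}).
Hypothesis Asub : forall x, A x \subset x.

Lemma survive_small (s t : R) (k : nat) : 0 <= s -> s <= t ->
  pr P [set w | (#|(A (restr n (Pi s w)) :&: restr n (Pi t w))%SET| < k)%N] <=
  pr P [set w | (#|A (restr n (Pi s w))| < k)%N] + k%:R * mu * (t - s).
Proof.
move=> s0 st.
pose Q (x z : {set {set 'I_n}}) := (#|(A x :&: z)%SET| < k)%N.
apply: le_trans (@pr_dynkin _ _ _ _ _ _ coal n s t Q (fun x z => (Q x z)%:R)
  (k%:R * mu) s0 st _ _ _) _.
- by [].
- by move=> x z ->.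
- by move=> x z; exact: drift_indic.
rewrite lerD2r -(sum_pr_restr_pred coal s (fun x => (#|A x| < k)%N)).
rewrite le_eqVlt; apply/orP; left; apply/eqP; apply: eq_bigr => x _.
by rewrite /Q (finset.setIidPl (Asub x)).
Qed.

Lemma survive_lyap (s t : R) (k M : nat) (eta C : R) : 0 < eta ->
  (forall u, (M <= u)%N -> lyap k eta u = 0) ->
  (\int[Lambda]_(p in D) (p ^- 2 * Num.min 1 (eta * (p / (1 - p))))%:E <= C%:E)%E ->
  0 <= s -> s <= t ->
  pr P [set w | (#|(A (restr n (Pi s w)) :&: restr n (Pi t w))%SET| < k)%N] <=
  pr P [set w | (#|A (restr n (Pi s w))| < M)%N] + C * (t - s).
Proof.
move=> eta0 HM hC s0 st.
pose Q (x z : {set {set 'I_n}}) := (#|(A x :&: z)%SET| < k)%N.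
pose f (x z : {set {set 'I_n}}) : R := lyap k eta #|(A x :&: z)%SET|.
apply: le_trans (@pr_dynkin _ _ _ _ _ _ coal n s t Q f C s0 st _ _ _) _.
- by move=> x z; exact: lyap_ge0.
- by move=> x z /ltnW Qxz; rewrite /f lyap_small.
- by move=> x z; exact: drift_lyap.
rewrite lerD2r -(sum_pr_restr_pred coal s (fun x => (#|A x| < M)%N)).
apply: ler_sum => x _; rewrite ler_wpM2l ?pr_ge0// /f (finset.setIidPl (Asub x)).
by case: ltnP => [_|/HM ->//]; exact: lyap_le1.
Qed.

End SurvivalSmall.

Lemma survive_large (k : nat) (T e : R) : 0 <= T -> 0 < e -> exists M : nat,
  forall n (A : {set {set 'I_n}} -> {set {set 'I_n}}) (s t : R),
  (forall x, A x \subset x) -> 0 <= s -> s <= t -> t - s <= T ->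
  pr P [set w | (#|(A (restr n (Pi s w)) :&: restr n (Pi t w))%SET| < k)%N] <=
  pr P [set w | (#|A (restr n (Pi s w))| < M)%N] + e.
Proof.
move=> T0 e0; have T10 : 0 < T + 1 by rewrite ltr_wpDl.
have [eta eta0 hC] := integral_min_ratio_small L1 mu1 (divr_gt0 e0 T10).
have [M HM] := lyap_large k eta0; exists M => n A s t As s0 st tsT.
apply: le_trans (survive_lyap As eta0 HM hC s0 st) _.
rewrite lerD2l mulrAC ler_pdivrMr// ler_wpM2l ?(ltW e0)//.
by lra.
Qed.

End Survival.

(** * Finitely many atomic blocks *)

Lemma sum_pr_comp (R : realType) (d : measure_display) (Omega : measurableType d)
    (P : probability Omega R) (T U : finType) (X : Omega -> T) (phi : T -> U) (g : U -> R) :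
  (forall x, measurable [set w | X w = x]) ->
  \sum_x pr P [set w | X w = x] * g (phi x) = \sum_u pr P [set w | phi (X w) = u] * g u.
Proof.
move=> mX; rewrite (partition_big phi predT)//=; apply: eq_bigr => u _.
have -> : [set w | phi (X w) = u] = [set w | (fun x => phi x == u) (X w)].
  by apply/seteqP; split => w /= /eqP.
by rewrite (pr_finE P mX (fun x => phi x == u)) mulr_suml; apply: eq_bigr => x /eqP ->.
Qed.

Section FiniteAtomicBlocks.
Variable R : realType.

Lemma atomic_nontrivial (E : nat -> nat -> bool) i :
  atomic R (E i) -> exists2 j, j != i & E i j.
Proof.
move=> [l l0 El]; apply: contrapT => nE.
have cnt k : (count (E i) (iota 0 k) <= 1)%N.
  apply: (@leq_trans (count_mem i (iota 0 k))).
    apply: sub_count => j Eij; apply/negPn/negP => ji.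
    by apply: nE; exists j.
  by rewrite count_uniq_mem ?iota_uniq//; case: (_ \in _).
suff : l = 0 by move=> l00; rewrite l00 ltxx in l0.
move: El; rewrite -cvg_shiftS => El.
apply: (cvg_unique _ El) => //.
apply: (@squeeze_cvgr _ _ _ _ (fun=> 0) (@harmonic R)).
- apply: nearW => k /=; rewrite divr_ge0//= ler_pdivrMr// mulVf// ?pnatr_eq0//.
  by rewrite lern1; exact: (cnt k.+1).
- exact: cvg_cst.
- exact: cvg_harmonic.
Qed.

Lemma bounded_has_max (K : nat -> nat) (a : nat) : (forall n, (K n < a)%N) ->
  exists n, forall m, (K m <= K n)%N.
Proof.
elim: a => [/(_ 0%N)//|a IH Ka].
have [[n Kn]|nK] := pselect (exists n, K n = a); first by exists n => m; rewrite Kn -ltnS.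
apply: IH => n; rewrite ltn_neqAle -ltnS Ka andbT; apply/eqP => Kn.
by apply: nK; exists n.
Qed.

Lemma finite_atomic_blocks (E : nat -> nat -> bool) (a : nat) : Defs.equiv_rel E ->
  (forall n, (#|nsb n (restr n E)| < a)%N) -> finite_set (atomic_blocks R E).
Proof.
move=> eqE /bounded_has_max[n nmax]; have [refl [sym tr]] := eqE.
apply: (@sub_finite_set _ _ ((fun i => [set j | E i j]) @` `I_n)); last first.
  exact/finite_image/finite_II.
move=> _ [i [-> /atomic_nontrivial[j ji Eij]]].
pose n' := maxn n (maxn i j).+1.
have nn' : (n <= n')%N by exact: leq_maxl.
have in' : (i < n')%N by rewrite (leq_trans _ (leq_maxr _ _))// ltnS leq_maxl.
have jn' : (j < n')%N by rewrite (leq_trans _ (leq_maxr _ _))// ltnS leq_maxr.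
have nsbE : nsb n (restr n' E) = nsb n' (restr n' E).
  apply/eqP; rewrite eqEcard nsb_subS//=.
  exact: leq_trans (nmax n') (leq_nsb_restr nn' eqE).
have : [set l : 'I_n' | E i l]%SET \in nsb n' (restr n' E).
  by apply: (@mem_nsb_restr n' n' E i i j in') => //; rewrite eq_sym.
rewrite -nsbE => /(nsb_restrP eqE)[i' [_ [i'n _ _ _ /setP/(_ i')]]].
rewrite !inE refl => Eii'; exists i' => //.
apply/seteqP; split => l /=; first exact: tr.
by move=> Eil; apply: tr Eil; exact: sym.
Qed.

End FiniteAtomicBlocks.

Section FiniteCase.
Variables (R : realType) (Lambda : {finite_measure set R -> \bar R}).
Hypothesis L1 : Lambda [set 1%R] = 0%E.
Hypothesis mu1 : (mu_neg Lambda 1 < +oo)%E.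
Hypothesis mu2 : (mu_neg Lambda 2 < +oo)%E.
Local Notation nu := (fine (mu_neg Lambda 2)).
Variables (d : measure_display) (Omega : measurableType d) (P : probability Omega R).
Variable Pi : R -> Omega -> nat -> nat -> bool.
Hypothesis coal : is_Lambda_coalescent Lambda P Pi.

Let K n (x : {set {set 'I_n}}) : R := #|nsb n x|%:R.

Lemma expected_growth n (s t : R) : 0 <= s -> s <= t ->
  \sum_xy pr P [set w | (restr n (Pi s w), restr n (Pi t w)) = xy] *
    Num.max 0 (K xy.2 - K xy.1) <= nu * (t - s).
Proof.
move=> s0 st; apply: le_trans (dynkin coal (f := fun x z => Num.max 0 (K z - K x))
  (c := nu) s0 st _) _.
  move=> x z.
  apply: (@drift_one _ _ L1 mu1 n z
    (fun S => Num.max 0 (K (Defs.merge z S) - K x) - Num.max 0 (K z - K x)) mu2) => S.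
  have KS : K (Defs.merge z S) <= K z + 1 by rewrite /K natr1 ler_nat nsb_merge.
  rewrite lerBlDr ge_max; apply/andP; split.
    by rewrite addr_ge0// le_max lexx.
  apply: (@le_trans _ _ (1 + (K z - K x))); first by lra.
  by rewrite lerD2l le_max lexx orbT.
rewrite big1 ?add0r// => x _.
by rewrite subrr maxxx mulr0.
Qed.

Lemma max_le_sum_pos (g : nat -> R) (N i : nat) : (i <= N)%N ->
  g i - g 0%N <= \sum_(0 <= j < N) Num.max 0 (g j.+1 - g j).
Proof.
move=> iN; apply: (@le_trans _ _ (\sum_(0 <= j < i) Num.max 0 (g j.+1 - g j))).
  rewrite -telescope_sumr//; apply: ler_sum => j _.
  by rewrite le_max lexx orbT.
rewrite (big_cat_nat (leq0n i) iN)/= lerDl; apply: sumr_ge0 => j _.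
by rewrite le_max lexx.
Qed.

Lemma grid_bound n N (T : R) (a : nat) : (0 < N)%N -> 0 <= T -> (0 < a)%N ->
  measurable [set w | [exists i : 'I_N.+1, (a <= #|nsb n (restr n (Pi (T * i%:R / N%:R) w))|)%N]] /\
  pr P [set w | [exists i : 'I_N.+1, (a <= #|nsb n (restr n (Pi (T * i%:R / N%:R) w))|)%N]]
    <= nu * T / a%:R.
Proof.
move=> N0 T0 a0.
pose tau (i : nat) : R := T * i%:R / N%:R.
pose X w : {ffun 'I_N.+1 -> {set {set 'I_n}}} := [ffun i : 'I_N.+1 => restr n (Pi (tau i) w)].
have mX f : measurable [set w | X w = f].
  have -> : [set w | X w = f] =
      \bigcap_(i in [set: 'I_N.+1]) [set w | restr n (Pi (tau i) w) = f i].
    apply/seteqP; split => [w /= <- i _|w Xf]; first by rewrite /= ffunE.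
    by apply/ffunP => i; rewrite ffunE; exact: Xf.
  by apply: fin_bigcap_measurable => // i _; exact: measurable_restr coal _ _ _.
pose Q (f : {ffun 'I_N.+1 -> {set {set 'I_n}}}) :=
  [exists i, (a <= #|nsb n (f i)|)%N] && (f ord0 == Defs.singletons n).
have -> : [set w | [exists i : 'I_N.+1, (a <= #|nsb n (restr n (Pi (T * i%:R / N%:R) w))|)%N]] =
    [set w | Q (X w)].
  have X0 w : X w ord0 = Defs.singletons n.
    by rewrite ffunE /tau mulr0 mul0r (coal0 coal).
  apply/seteqP; split => w /=; rewrite /Q X0 eqxx andbT => /existsP[i ai]; apply/existsP; exists i.
    by rewrite ffunE.
  by move: ai; rewrite ffunE.
split; first exact: measurable_fin.
pose W (f : {ffun 'I_N.+1 -> {set {set 'I_n}}}) :=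
  \sum_(0 <= j < N) Num.max 0 (K (f (inord j.+1)) - K (f (inord j))).
have W0 f : 0 <= W f by apply: sumr_ge0 => j _; rewrite le_max lexx.
have ar : 0 < a%:R :> R by rewrite ltr0n.
apply: le_trans (markov_fin P mX (Q := Q) (f := fun f => W f / a%:R) _ _) _.
- by move=> f; rewrite divr_ge0.
- move=> f /andP[/existsP[i ai] /eqP f0]; rewrite ler_pdivlMr// mul1r.
  have := @max_le_sum_pos (fun j => K (f (inord j))) N i (leq_ord i).
  apply: le_trans; rewrite inord_val.
  have -> : K (f (inord 0)) = 0.
    rewrite /K (_ : inord 0 = ord0); last by apply: val_inj; rewrite /= inordK.
    by rewrite f0 nsb_singletons cards0.
  by rewrite subr0 ler_nat.
under eq_bigr do rewrite mulrA.
rewrite -mulr_suml ler_pM2r ?invr_gt0//.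
under eq_bigr do rewrite /W mulr_sumr.
rewrite exchange_big /=.
apply: (@le_trans _ _ (\sum_(0 <= j < N) nu * (T / N%:R))); last first.
  rewrite sumr_const_nat subn0 -[_ *+ _]mulr_natr -!mulrA.
  by rewrite mulVf ?mulr1// pnatr_eq0 -lt0n.
rewrite big_nat [leRHS]big_nat; apply: ler_sum => j /andP[_ jN].
rewrite (sum_pr_comp P
  (fun f : {ffun 'I_N.+1 -> {set {set 'I_n}}} => (f (inord j), f (inord j.+1)))
  (fun xy => Num.max 0 (K xy.2 - K xy.1)) mX).
have -> : T / N%:R = tau j.+1 - tau j.
  by rewrite /tau -natr1; field; rewrite pnatr_eq0 -lt0n.
apply: le_trans (expected_growth n (s := tau j) (t := tau j.+1) _ _).
- rewrite le_eqVlt; apply/orP; left; apply/eqP; apply: eq_bigr => xy _; congr (pr P _ * _).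
  apply/seteqP; split => w /=; rewrite /X !ffunE !inordK// ltnS ltnW//.
- by rewrite /tau divr_ge0// mulr_ge0.
- by rewrite /tau ler_wpM2r ?invr_ge0// ler_wpM2l// ler_nat.
Qed.

End FiniteCase.

Section FiniteCaseAE.
Variables (R : realType) (Lambda : {finite_measure set R -> \bar R}).
Hypothesis L1 : Lambda [set 1%R] = 0%E.
Hypothesis mu1 : (mu_neg Lambda 1 < +oo)%E.
Hypothesis mu2 : (mu_neg Lambda 2 < +oo)%E.
Variables (d : measure_display) (Omega : measurableType d) (P : probability Omega R).
Variable Pi : R -> Omega -> nat -> nat -> bool.
Hypothesis coal : is_Lambda_coalescent Lambda P Pi.
Local Notation nu := (fine (mu_neg Lambda 2)).

Lemma dyadic_dense (T t e : R) (n : nat) : 0 < t -> t < T -> 0 < e ->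
  exists r i : nat, [/\ (n <= r)%N, (i <= 2 ^ r)%N &
    t <= T * i%:R / (2 ^ r)%:R < t + e].
Proof.
move=> t0 tT e0; have T0 : 0 < T by exact: lt_trans tT.
pose e' := Num.min e (T - t).
have e'0 : 0 < e' by rewrite lt_min e0 subr_gt0.
pose r := maxn n (Num.truncn (T / e')).+1.
have rT : T / (2 ^ r)%:R < e'.
  rewrite ltr_pdivrMr ?ltr0n ?expn_gt0// mulrC -ltr_pdivrMr//.
  apply: lt_trans (truncnS_gt _) _; rewrite ltr_nat.
  by apply: leq_ltn_trans (leq_maxr n _) _; exact: ltn_expl.
have N0 : 0 < (2 ^ r)%:R :> R by rewrite ltr0n expn_gt0.
set N := (2 ^ r)%:R in rT N0.
pose i := (Num.truncn (t * N / T)).+1.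
have it : t < T * i%:R / N.
  rewrite ltr_pdivlMr// mulrC [ltRHS]mulrC -ltr_pdivrMr// [N * t]mulrC.
  exact: truncnS_gt.
have ie : T * i%:R / N < t + e'.
  have ile : i%:R <= t * N / T + 1.
    rewrite /i -natr1 lerD2r truncn_le//.
    by rewrite divr_ge0 ?mulr_ge0// ltW.
  apply: (@le_lt_trans _ _ (t + T / N)); last by rewrite ltrD2l.
  have -> : t + T / N = T * (t * N / T + 1) / N by field; rewrite !gt_eqF.
  by rewrite ler_pM2r ?invr_gt0// ler_pM2l.
exists r, i; split; first exact: leq_maxl.
- apply: ltnW; rewrite -(ltr_nat R) -/N.
  have : T * i%:R / N < T.
    apply: lt_le_trans ie _; rewrite -lerBrDl.
    by rewrite ge_min lexx orbT.
  by rewrite ltr_pdivrMr// ltr_pM2l.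
- rewrite (ltW it) /=; apply: lt_le_trans ie _; rewrite lerD2l.
  by rewrite ge_min lexx.
Qed.

Lemma ae_finite_atomic_blocks : {ae P, forall w, forall t : R, 0 < t ->
  finite_set (atomic_blocks R (Pi t w))}.
Proof.
pose A (j : nat) := [set w | exists t : R, [/\ 0 < t, t < j.+1%:R &
  ~ finite_set (atomic_blocks R (Pi t w))]].
suff A0 j : P.-negligible (A j).
  apply: negligibleS (negligible_bigcup A0) => w /= H.
  apply: contrapT => nA; apply: H => t t0; apply: contrapT => nf; apply: nA.
  exists (Num.truncn t) => //; exists t; split => //; exact: truncnS_gt.
apply: negligible_small => e e0.
set T := j.+1%:R : R; have T0 : 0 <= T by [].
pose a := (Num.truncn (nu * T / e)).+1.
have ae : nu * T / a%:R <= e.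
  by rewrite ler_pdivrMr// [leRHS]mulrC -ler_pdivrMr// ltW// truncnS_gt.
pose C (r : nat) := [set w | [exists i : 'I_(2 ^ r).+1,
  (a <= #|nsb r (restr r (Pi (T * i%:R / (2 ^ r)%:R) w))|)%N]].
have N0 r : (0 < 2 ^ r)%N by rewrite expn_gt0.
have mC r : measurable (C r).
  by have [] := grid_bound L1 mu1 mu2 coal r (N0 r) T0 (ltn0Sn (Num.truncn (nu * T / e))).
have prC r : pr P (C r) <= e.
  have [_ H] := grid_bound L1 mu1 mu2 coal r (N0 r) T0 (ltn0Sn (Num.truncn (nu * T / e))).
  exact: le_trans H ae.
have ndC : nondecreasing_seq C.
  apply/nondecreasing_seqP => r; apply/subsetPset => w /= /existsP[i ai].
  have i2 : (2 * i < (2 ^ r.+1).+1)%N by rewrite expnS ltnS leq_pmul2l// leq_ord.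
  apply/existsP; exists (Ordinal i2) => /=.
  have -> : T * (2 * i)%:R / (2 ^ r.+1)%:R = T * i%:R / (2 ^ r)%:R.
    rewrite expnS !natrM; field.
    by rewrite pnatr_eq0 -lt0n N0.
  by apply: leq_trans ai _; apply: leq_nsb => //; exact: equiv_coal coal _ _.
exists (\bigcup_r C r); split.
- exact: bigcupT_measurable.
- move=> w [t [t0 tT nf]].
  have [n an] : exists n, (a <= #|nsb n (restr n (Pi t w))|)%N.
    apply: contrapT => H; apply: nf.
    apply: (@finite_atomic_blocks _ _ a); first exact: equiv_coal coal _ _.
    by move=> n; rewrite ltnNge; apply/negP => an; apply: H; exists n.
  have [_ [_ [_ [/(_ n w t (ltW t0))[e1 e10 He1] _]]]] := coal.
  have [r [i [nr ir /He1 E]]] := dyadic_dense n t0 tT e10.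
  exists r => //=; apply/existsP; exists (Ordinal (ir : (i < (2 ^ r).+1)%N)) => /=.
  apply: leq_trans an _; rewrite -E.
  by apply: leq_nsb => //; exact: equiv_coal coal _ _.
- exact: pr_bigcup_le.
Qed.

End FiniteCaseAE.

(** * Exchangeability *)

Section Exchangeability.
Import mathcomp.boot.fintype mathcomp.boot.finset.
Variables (R : realType) (Lambda : {finite_measure set R -> \bar R}) (n : nat).
Variable sigma : {perm 'I_n}.
Implicit Types (x y z S : {set {set 'I_n}}).

Definition relabel x : {set {set 'I_n}} := [set [set sigma i | i in b] | b : {set 'I_n} in x]%SET.

Lemma relabel_block_inj : injective (fun b : {set 'I_n} => [set sigma i | i in b]%SET).
Proof. exact/imset_inj/perm_inj. Qed.

Lemma relabel_inj : injective relabel.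
Proof. exact/imset_inj/relabel_block_inj. Qed.

Lemma card_relabel x : #|relabel x| = #|x|.
Proof. exact: card_imset relabel_block_inj. Qed.

Lemma mem_relabel x (b : {set 'I_n}) : ([set sigma i | i in b]%SET \in relabel x) = (b \in x).
Proof. exact: mem_imset relabel_block_inj. Qed.

Lemma cover_relabel S : cover (relabel S) = [set sigma i | i in cover S]%SET.
Proof.
apply/setP => j; apply/bigcupP/imsetP => [[b /imsetP[b0 b0S ->] /imsetP[i ib ->]]|[i]].
  by exists i => //; apply/bigcupP; exists b0.
move=> /bigcupP[b bS ib ->]; exists [set sigma i | i in b]%SET; last exact: imset_f.
by rewrite mem_relabel.
Qed.

Lemma merge_relabel x S : Defs.merge (relabel x) (relabel S) = relabel (Defs.merge x S).
Proof.
apply/setP => b; rewrite !inE cover_relabel.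
apply/orP/imsetP => [[/andP[bS /imsetP[b0 b0x bE]]|/eqP bE]|[b0 + bE]].
- by exists b0 => //; rewrite !inE b0x; move: bS; rewrite bE mem_relabel => ->.
- by exists (cover S) => //; rewrite !inE eqxx orbT.
- rewrite !inE => /orP[/andP[b0S b0x]|/eqP b0E].
    by left; rewrite bE !mem_relabel b0S.
  by right; rewrite bE b0E.
Qed.

Lemma subset_relabel S x : (relabel S \subset relabel x) = (S \subset x).
Proof.
apply/idP/idP => [/subsetP H|]; last exact: imsetS.
by apply/subsetP => b bS; rewrite -mem_relabel H// mem_relabel.
Qed.

Lemma rate_relabel x y : rate Lambda (relabel x) (relabel y) = rate Lambda x y.
Proof.
rewrite /rate (reindex_inj relabel_inj) /=; apply: eq_big => [S|S _]; last first.
  by rewrite !card_relabel.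
by rewrite !powersetE subset_relabel card_relabel merge_relabel (inj_eq relabel_inj).
Qed.

Lemma gen_relabel x y : gen Lambda (relabel x) (relabel y) = gen Lambda x y.
Proof.
rewrite /gen rate_relabel (inj_eq relabel_inj); congr (_ - _ * _).
by rewrite (reindex_inj relabel_inj) /=; apply: eq_bigr => z _; exact: rate_relabel.
Qed.

Lemma genpow_relabel k x y : genpow Lambda k (relabel x) (relabel y) = genpow Lambda k x y.
Proof.
elim: k x y => [|k IH] x y /=; first by rewrite (inj_eq relabel_inj).
rewrite (reindex_inj relabel_inj) /=; apply: eq_bigr => z _.
by rewrite IH gen_relabel.
Qed.

Lemma trans_relabel t x y : trans Lambda t (relabel x) (relabel y) = trans Lambda t x y.
Proof.
rewrite /trans; congr (lim (_ @ \oo)); apply/funext => N.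
by apply: eq_bigr => k _; rewrite genpow_relabel.
Qed.

Lemma relabel_singletons : relabel (Defs.singletons n) = Defs.singletons n.
Proof.
apply/setP => b; apply/imsetP/imsetP => [[_ /imsetP[i _ ->] ->]|[i _ ->]].
  by exists (sigma i); rewrite ?imset_set1.
exists [set (sigma^-1)%g i]%SET; first exact: imset_f.
by rewrite imset_set1 permKV.
Qed.

Lemma joined_relabel x i j : joined (relabel x) (sigma i) (sigma j) = joined x i j.
Proof.
apply/exists_inP/exists_inP => [[_ /imsetP[b bx ->]]|[b bx /andP[ib jb]]].
  by rewrite !mem_imset//; [move=> ijb; exists b|exact: perm_inj..].
by exists [set sigma i | i in b]%SET; rewrite ?mem_relabel// !imset_f.
Qed.

Variables (d : measure_display) (Omega : measurableType d) (P : probability Omega R).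
Variable Pi : R -> Omega -> nat -> nat -> bool.
Hypothesis coal : is_Lambda_coalescent Lambda P Pi.

Lemma pr_relabel (s : R) (Q : pred {set {set 'I_n}}) : 0 <= s ->
  pr P [set w | Q (restr n (Pi s w))]%classic =
  pr P [set w | Q (relabel (restr n (Pi s w)))]%classic.
Proof.
move=> s0; rewrite (pr_finE P (@measurable_restr _ _ _ _ _ _ coal n s) Q).
rewrite (pr_finE P (@measurable_restr _ _ _ _ _ _ coal n s) (fun x => Q (relabel x))).
rewrite (reindex_inj relabel_inj) /=; apply: eq_bigr => x _.
rewrite !(pr_restr coal _ s0) -[in RHS]trans_relabel.
by rewrite relabel_singletons.
Qed.

End Exchangeability.

Section AtomicBlocks.
Variables (R : realType) (Lambda : {finite_measure set R -> \bar R}).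
Variables (d : measure_display) (Omega : measurableType d) (P : probability Omega R).
Variable Pi : R -> Omega -> nat -> nat -> bool.
Hypothesis coal : is_Lambda_coalescent Lambda P Pi.
Variable s : R.
Hypothesis s0 : 0 <= s.

Lemma pr_joined_swap n (i u u' : 'I_n) (Z : pred {set {set 'I_n}}) : u != i -> u' != i ->
  (forall x, Z (relabel (tperm u u') x) = Z x) ->
  pr P [set w | joined (restr n (Pi s w)) i u && Z (restr n (Pi s w))] =
  pr P [set w | joined (restr n (Pi s w)) i u' && Z (restr n (Pi s w))].
Proof.
move=> ui u'i ZE.
rewrite (pr_relabel (tperm u u') coal (fun x => joined x i u && Z x) s0).
congr (pr P _); apply/seteqP.
have E x : joined (relabel (tperm u u') x) i u = joined x i u'.
  rewrite -(joined_relabel (tperm u u') x i u') tpermR tpermD//.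
by split => w /=; rewrite ZE E.
Qed.

Lemma pr_pair_swap (i u u' v : nat) : u != i -> u' != i -> v != i ->
  u != v -> u' != v ->
  pr P [set w | Pi s w i u && Pi s w i v] = pr P [set w | Pi s w i u' && Pi s w i v].
Proof.
move=> ui u'i vi uv u'v.
pose n := (i + u + u' + v).+1.
have iN : (i < n)%N by rewrite /n; lia.
have uN : (u < n)%N by rewrite /n; lia.
have u'N : (u' < n)%N by rewrite /n; lia.
have vN : (v < n)%N by rewrite /n; lia.
have := @pr_joined_swap n (Ordinal iN) (Ordinal uN) (Ordinal u'N)
  (fun x => joined x (Ordinal iN) (Ordinal vN)) ui u'i.
have E w a b (aN : (a < n)%N) (bN : (b < n)%N) :
    joined (restr n (Pi s w)) (Ordinal aN) (Ordinal bN) = Pi s w a b.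
  exact: joined_restr (equiv_coal coal s w).
have SE a (aN : (a < n)%N) : [set w | joined (restr n (Pi s w)) (Ordinal iN) (Ordinal aN) &&
    joined (restr n (Pi s w)) (Ordinal iN) (Ordinal vN)] = [set w | Pi s w i a && Pi s w i v].
  by apply/seteqP; split => w /=; rewrite !E.
rewrite !SE; apply => x.
rewrite -[in RHS](joined_relabel (tperm (Ordinal uN) (Ordinal u'N)) x).
by rewrite !tpermD// -val_eqE.
Qed.

Lemma pr_single_swap (i u u' : nat) : u != i -> u' != i ->
  pr P [set w | Pi s w i u] = pr P [set w | Pi s w i u'].
Proof.
move=> ui u'i.
pose n := (i + u + u').+1.
have iN : (i < n)%N by rewrite /n; lia.
have uN : (u < n)%N by rewrite /n; lia.
have u'N : (u' < n)%N by rewrite /n; lia.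
have := @pr_joined_swap n (Ordinal iN) (Ordinal uN) (Ordinal u'N) predT ui u'i (fun=> erefl).
have E w a b (aN : (a < n)%N) (bN : (b < n)%N) :
    joined (restr n (Pi s w)) (Ordinal aN) (Ordinal bN) = Pi s w a b.
  exact: joined_restr (equiv_coal coal s w).
have SE a (aN : (a < n)%N) : [set w | joined (restr n (Pi s w)) (Ordinal iN) (Ordinal aN) &&
    predT (restr n (Pi s w))] = [set w | Pi s w i a].
  by apply/seteqP; split => w /=; rewrite !E andbT.
by rewrite !SE.
Qed.

Lemma pr_pair_const (i u v u' v' : nat) : u != i -> v != i -> u' != i -> v' != i ->
  u != v -> u' != v' ->
  pr P [set w | Pi s w i u && Pi s w i v] = pr P [set w | Pi s w i u' && Pi s w i v'].
Proof.
move=> ui vi u'i v'i uv u'v'.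
pose f a b := pr P [set w | Pi s w i a && Pi s w i b].
have fC a b : f a b = f b a.
  by congr (pr P _); apply/seteqP; split => w /=; rewrite andbC.
have swap a a' b : a != i -> a' != i -> b != i -> a != b -> a' != b -> f a b = f a' b.
  exact: pr_pair_swap.
rewrite -/(f u v) -/(f u' v').
have [u'E|u'v] := eqVneq u' v; last first.
  rewrite (swap u u' v)// fC [RHS]fC; apply: swap => //; first by rewrite eq_sym.
  by rewrite eq_sym.
have [v'E|v'u] := eqVneq v' u; first by rewrite u'E v'E fC.
by rewrite (swap u v' v)// -?u'E 1?fC// 1?eq_sym// u'E.
Qed.

Lemma ae_cvg_block_mean (i : nat) :
  {ae P, forall w, cvgn (fun k : nat => (\sum_(r < k) (Pi s w i (bump i r))%:R) / k%:R : R)}.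
Proof.
have bi r : bump i r != i by rewrite eq_sym neq_bump.
apply: (@ae_cvg_mean _ _ _ P (fun r w => Pi s w i (bump i r)) (pr P [set w | Pi s w i (bump i 0)])
  (pr P [set w | Pi s w i (bump i 0) && Pi s w i (bump i 1)])).
- by move=> r; exact: measurable_coal coal _ _ _.
- by move=> r; exact: pr_single_swap.
- move=> r q rq; apply: pr_pair_const => //.
  by rewrite (inj_eq (can_inj (bumpK i))).
  by rewrite (inj_eq (can_inj (bumpK i))).
Qed.

Lemma count_iotaE (b : pred nat) k :
  (count b (iota 0 k))%:R = \sum_(l < k) (b l)%:R :> R.
Proof.
rewrite -sum1_count big_mkcond /= natr_sum -{1}(subn0 k) -/(index_iota 0 k) big_mkord.
by apply: eq_bigr => l _; case: (b l).
Qed.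

Lemma cvg_frequency (E : nat -> nat -> bool) i (L : R) : E i i ->
  (fun k : nat => (\sum_(r < k) (E i (bump i r))%:R) / k%:R) @ \oo --> L ->
  (fun k : nat => (count (E i) (iota 0 k))%:R / k%:R) @ \oo --> L.
Proof.
move=> Eii cvL; rewrite -cvg_shiftS.
set m := (fun k : nat => _ / _) in cvL.
have : (fun k => m k + (1 - m k) * k.+1%:R^-1) @ \oo --> L + (1 - L) * 0.
  by apply: cvgD => //; apply: cvgM; [apply: cvgB => //; exact: cvg_cst|exact: cvg_harmonic].
rewrite mulr0 addr0; apply: cvg_trans; apply: near_eq_cvg.
have : \forall k \near \oo, (count (E i) (iota 0 k.+1))%:R / k.+1%:R =
    m k + (1 - m k) * k.+1%:R^-1 :> R.
  near=> k.
  have ik : (i < k.+1)%N by near: k; exists i => // k /=; rewrite ltnS.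
  have k0 : k%:R != 0 :> R by near: k; exists 1%N => // k; rewrite pnatr_eq0 -lt0n.
  rewrite count_iotaE (bigD1_ord (Ordinal ik))//= Eii /m /=.
  rewrite (eq_bigr (fun r : 'I_k => (E i (bump i r))%:R))//.
  have k1 : k%:R + 1 != 0 :> R by rewrite natr1 pnatr_eq0.
  by rewrite -natr1; field; rewrite ?k0 ?natr1 ?pnatr_eq0 ?andbT.
by apply: filterS => k <-.
Unshelve. all: by end_near. Qed.

Lemma pr_small_block n (i j : 'I_n.+1) (c : nat) : i != j ->
  n%:R * pr P [set w | joined (restr n.+1 (Pi s w)) i j &&
    (#|[set l | joined (restr n.+1 (Pi s w)) i l]%SET| <= c)%N] <= c%:R.
Proof.
move=> ij.
pose Z (x : {set {set 'I_n.+1}}) := (#|[set l | joined x i l]%SET| <= c)%N.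
pose p (x : {set {set 'I_n.+1}}) := pr P [set w | restr n.+1 (Pi s w) = x].
have mX := @measurable_restr _ _ _ _ _ _ coal n.+1 s.
have Zswap u u' : u != i -> u' != i -> forall x, Z (relabel (tperm u u') x) = Z x.
  move=> ui u'i x; rewrite /Z; congr (_ <= _)%N.
  rewrite -[RHS](card_imset _ (@perm_inj _ (tperm u u'))).
  apply: eq_card => l; rewrite [in LHS]inE.
  rewrite -[l in RHS](permKV (tperm u u')) mem_imset; last exact: perm_inj.
  rewrite inE -(joined_relabel (tperm u u') x i) permKV.
  by rewrite [in RHS]tpermD.
have <- : \sum_(l | l != i) pr P [set w | joined (restr n.+1 (Pi s w)) i l && Z (restr n.+1 (Pi s w))] =
    n%:R * pr P [set w | joined (restr n.+1 (Pi s w)) i j && Z (restr n.+1 (Pi s w))].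
  rewrite (eq_bigr (fun=> pr P [set w | joined (restr n.+1 (Pi s w)) i j && Z (restr n.+1 (Pi s w))])).
    rewrite sumr_const mulr_natl; congr (_ *+ _).
    by rewrite cardC1 card_ord.
  move=> l li; apply: pr_joined_swap => //; first by rewrite eq_sym.
  by apply: Zswap => //; rewrite eq_sym.
rewrite (eq_bigr (fun l => \sum_x p x * (joined x i l && Z x)%:R)); last first.
  move=> l _; rewrite (pr_finE P mX (fun x => joined x i l && Z x)) [LHS]big_mkcond /=.
  by apply: eq_bigr => x _; case: (_ && _); rewrite ?mulr1 ?mulr0.
rewrite exchange_big /= -[leRHS]mul1r -[X in _ <= X * _](sum_pr_fin P mX) mulr_suml.
apply: ler_sum => x _; rewrite -mulr_sumr ler_wpM2l ?pr_ge0//.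
rewrite -(natr_sum _ _ _ (fun l => nat_of_bool (joined x i l && Z x))) ler_nat.
have [Zx|nZx] := boolP (Z x); last by rewrite big1// => l _; rewrite andbF.
apply: leq_trans Zx; rewrite -sum1_card big_mkcond [leqRHS]big_mkcond /=.
apply: leq_sum => l _; rewrite inE; case: (l != i) => //.
by case: (joined x i l).
Qed.

Lemma negligible_null_block (i j : nat) : i != j ->
  P.-negligible [set w | Pi s w i j /\
    (fun k : nat => (count (Pi s w i) (iota 0 k))%:R / k%:R : R) @ \oo --> (0 : R)].
Proof.
move=> ij; apply: negligible_small => e e0.
pose F (n : nat) := [set w | Pi s w i j &&
  ((count (Pi s w i) (iota 0 n))%:R <= 2^-1 * e * n%:R :> R)].
pose m := (i + j).+2.
have card_cnt n w (iN : (i < n)%N) : count (Pi s w i) (iota 0 n) =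
    #|[set l | joined (restr n (Pi s w)) (Ordinal iN) l]%SET|.
  apply/eqP; rewrite -(eqr_nat R) count_iotaE -sum1_card natr_sum [eqbRHS]big_mkcond /=.
  apply/eqP; apply: eq_bigr => l _; rewrite inE joined_restr; last exact: equiv_coal coal _ _.
  by rewrite /=; case: (Pi s w i l).
have FE n : (m <= n.+1)%N -> measurable (F n.+1) /\ pr P (F n.+1) <= e.
  move=> mn.
  have iN : (i < n.+1)%N by rewrite /m in mn; lia.
  have jN : (j < n.+1)%N by rewrite /m in mn; lia.
  have n0 : (0 < n)%N by rewrite /m in mn; lia.
  pose c := Num.truncn (2^-1 * e * n.+1%:R).
  have x0 : 0 <= 2^-1 * e * n.+1%:R by rewrite !mulr_ge0// ?invr_ge0// ltW.
  have -> : F n.+1 = [set w | (fun x => joined x (Ordinal iN) (Ordinal jN) &&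
      (#|[set l | joined x (Ordinal iN) l]%SET| <= c)%N) (restr n.+1 (Pi s w))].
    apply/seteqP; rewrite /F.
    by split => w /=; rewrite -card_cnt joined_restr ?truncn_ge_nat//; exact: equiv_coal coal _ _.
  split; first exact: (measurable_restr_pred coal s (fun x => joined x (Ordinal iN) (Ordinal jN) &&
      (#|[set l | joined x (Ordinal iN) l]%SET| <= c)%N)).
  have nr : 0 < n%:R :> R by rewrite ltr0n.
  have := @pr_small_block n (Ordinal iN) (Ordinal jN) c; rewrite -val_eqE /= => /(_ ij).
  rewrite mulrC -ler_pdivlMr// => H; apply: le_trans H _.
  rewrite ler_pdivrMr//; apply: (@le_trans _ _ (2^-1 * e * n.+1%:R)); first by rewrite truncn_le.
  rewrite mulrAC [leRHS]mulrC ler_pM2r// -[n.+1%:R]natr1.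
  have : 1 <= n%:R :> R by rewrite ler1n.
  by lra.
pose A (N : nat) := \bigcap_(n in [set n | (m + N <= n.+1)%N]) F n.+1.
have mA N : measurable (A N).
  apply: bigcap_measurable => [|n /= Nn]; first by exists (m + N)%N => /=; exact: leqnSn.
  by have [] := FE n (leq_trans (leq_addr _ _) Nn).
exists (\bigcup_N A N); split.
- exact: bigcupT_measurable.
- move=> w [wij /cvgrPdist_le /(_ (2^-1 * e))[]]; first by rewrite mulr_gt0// invr_gt0.
  move=> N _ HN; exists N => // n /= Nn; rewrite /F /= wij /=.
  have := HN n.+1; rewrite /= sub0r normrN.
  have -> : (N <= n.+1)%N by apply: leq_trans Nn; rewrite leq_addl.
  move=> /(_ isT); rewrite ger0_norm ?divr_ge0//.
  by rewrite ler_pdivrMr.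
- apply: pr_bigcup_le => //.
    move=> N N' NN'; apply/subsetPset => w AN n /= N'n; apply: AN => /=.
    by apply: leq_trans N'n; rewrite leq_add2l.
  move=> N; have mN : (m <= (m + N).+1)%N by rewrite leqW// leq_addr.
  have [mF pF] := FE (m + N)%N mN.
  apply: le_trans pF; apply: le_pr => // w; apply => /=.
  exact: leqnSn.
Qed.

Lemma negligible_not_atomic (i j : nat) : i != j ->
  P.-negligible [set w | Pi s w i j /\ ~ atomic R (Pi s w i)].
Proof.
move=> ij.
apply: negligibleS (negligibleU (negligible_null_block ij) (ae_cvg_block_mean i)).
move=> w [wij na].
have [cv|ncv] := pselect (cvgn (fun k : nat =>
  (\sum_(r < k) (Pi s w i (bump i r))%:R) / k%:R : R)); last by right.
left; split => //.
have wii : Pi s w i i by have [-> _] := equiv_coal coal s w.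
have fcv := cvg_frequency wii cv.
set L := lim _ in fcv.
have L0 : 0 <= L.
  apply: limr_ge => //; apply: nearW => k.
  by rewrite divr_ge0// sumr_ge0.
suff L00 : L = 0 by rewrite -L00.
apply/eqP; rewrite eq_le L0 andbT leNgt; apply/negP => Lp.
by apply: na; exists L.
Qed.

End AtomicBlocks.

(** * Infinitely many atomic blocks *)

Section CommonBlocks.
Import mathcomp.boot.fintype mathcomp.boot.finset.

Lemma mem_restrE n (E : nat -> nat -> bool) (b : {set 'I_n}) (i : 'I_n) :
  Defs.equiv_rel E -> b \in restr n E -> i \in b -> b = [set l : 'I_n | E i l]%SET.
Proof.
move=> [refl [sym tr]] /imsetP[k _ ->]; rewrite inE => ki.
apply/setP => l; rewrite !inE; apply/idP/idP => [kl|il].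
  exact: tr (sym _ _ ki) kl.
exact: tr ki il.
Qed.

Lemma leq_common n n' m (E E' : nat -> nat -> bool) : (m <= n)%N -> (n <= n')%N ->
  Defs.equiv_rel E -> Defs.equiv_rel E' ->
  (#|nsb m (restr n' E) :&: restr n' E'| <= #|nsb m (restr n E) :&: restr n E'|)%N.
Proof.
move=> mn nn' eqE eqE'.
have [refl [sym tr]] := eqE.
pose r (b : {set 'I_n'}) : {set 'I_n} := [set l : 'I_n | widen_ord nn' l \in b]%SET.
have key b : b \in nsb m (restr n' E) :&: restr n' E' -> exists i : 'I_n,
    [/\ b = [set l : 'I_n' | E i l]%SET, r b = [set l : 'I_n | E i l]%SET,
        r b \in nsb m (restr n E) & r b \in restr n E'].
  rewrite inE => /andP[/(nsb_restrP eqE)[i [j [im jm ij Eij bE]]] bE'].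
  have iN : (i < n)%N by exact: leq_trans im mn.
  exists (Ordinal iN).
  have rbE : r b = [set l : 'I_n | E i l]%SET by apply/setP => l; rewrite !inE bE inE.
  split=> //.
    by rewrite rbE; apply: (@mem_nsb_restr n m E i i j iN).
  have ib : i \in b by rewrite bE inE refl.
  have := mem_restrE eqE' bE' ib => bE2.
  have -> : r b = [set l : 'I_n | E' i l]%SET by apply/setP => l; rewrite !inE bE2 inE.
  by apply/imsetP; exists (Ordinal iN).
rewrite -(card_in_imset (f := r)).
  apply: subset_leq_card; apply/subsetP => _ /imsetP[b /key[i [_ _ rb rb']] ->].
  by rewrite inE rb rb'.
move=> b1 b2 /key[i1 [b1E r1E _ _]] /key[i2 [b2E r2E _ _]] rb.
have : i1 \in r b2 by rewrite -rb r1E inE.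
rewrite r2E inE => E21; rewrite b1E b2E; apply/setP => l; rewrite !inE.
by apply/idP/idP; apply: tr; [|apply: sym].
Qed.

Definition good m (Q : nat -> bool) (E : nat -> nat -> bool) (i : 'I_m) :=
  [&& [forall l : 'I_m, (l < i)%N ==> ~~ E i l],
      [exists l : 'I_m, (l != i) && E i l] & Q i].

Lemma card_common n m (E E' : nat -> nat -> bool) : (m <= n)%N ->
  Defs.equiv_rel E -> Defs.equiv_rel E' ->
  (#|nsb m (restr n E) :&: restr n E'| <=
   #|[set i : 'I_m | good (fun i => [forall l : 'I_n, E i l == E' i l]) E i]%SET|)%N.
Proof.
move=> mn eqE eqE'; have [refl [sym tr]] := eqE.
apply: leq_trans (leq_imset_card (fun i : 'I_m => [set l : 'I_n | E i l]%SET) _).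
apply: subset_leq_card; apply/subsetP => b.
rewrite inE => /andP[/(nsb_restrP eqE)[i0 [j0 [i0m j0m ij0 Eij0 bE]]] bE'].
have exi : exists i, E i0 i by exists i0; exact: refl.
have [i Ei0i imin] := ex_minnP exi.
have im : (i < m)%N by apply: leq_ltn_trans (imin _ (refl i0)) i0m.
have iN : (i < n)%N by exact: leq_trans im mn.
have ib : Ordinal iN \in b by rewrite bE inE.
apply/imsetP; exists (Ordinal im); last first.
  apply/setP => l; rewrite bE !inE /=; apply/idP/idP; last exact: tr.
  by apply: tr; exact: sym.
rewrite inE; apply/and3P; split => /=.
- apply/forallP => l; apply/implyP => li; apply/negP => Eil.
  by have := imin _ (tr _ _ _ Ei0i Eil); rewrite leqNgt li.
- apply/existsP; have [i0i|i0i] := eqVneq (i0 : nat) i.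
    exists (Ordinal j0m); rewrite -val_eqE /= -i0i eq_sym val_eqE ij0 /=.
    by rewrite i0i in Eij0 *.
  by exists (Ordinal i0m); rewrite -val_eqE /= i0i /=; exact: sym.
- apply/forallP => l; have := mem_restrE eqE' bE' ib => /setP/(_ l).
  rewrite bE !inE /= => <-; apply/eqP; apply/idP/idP; first exact: tr.
  by apply: tr; exact: sym.
Qed.

Lemma card_common_limit m k (E E' : nat -> nat -> bool) :
  Defs.equiv_rel E -> Defs.equiv_rel E' ->
  (forall n, (m <= n)%N -> (k <= #|nsb m (restr n E) :&: restr n E'|)%N) ->
  (k <= #|[set i : 'I_m | good (fun i => `[< forall l, E i l = E' i l >]) E i]%SET|)%N.
Proof.
move=> eqE eqE' H.
have /choice[N HN] : forall i : 'I_m, exists N,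
    (forall l, (l < N)%N -> E i l = E' i l) -> forall l, E i l = E' i l.
  move=> i; have [Eall|/existsNP[l El]] := pselect (forall l, E i l = E' i l).
    by exists 0%N.
  by exists l.+1 => /(_ l (ltnSn l)).
pose n := (m + \max_i N i)%N.
apply: leq_trans (H n (leq_addr _ _)) _.
apply: leq_trans (card_common (leq_addr _ _) eqE eqE') _.
apply: subset_leq_card; apply/subsetP => i; rewrite !inE /good => /and3P[-> -> /forallP Ei] /=.
apply/asboolP/HN => l lN.
have ln : (l < n)%N by rewrite /n; apply: leq_trans lN _; rewrite (leq_trans (leq_bigmax i))// leq_addl.
by have /eqP := Ei (Ordinal ln).
Qed.

End CommonBlocks.

Section ManyBlocks.
Variables (R : realType) (Lambda : {finite_measure set R -> \bar R}).
Hypothesis L1 : Lambda [set 1%R] = 0%E.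
Hypothesis mu1 : (mu_neg Lambda 1 < +oo)%E.
Hypothesis mu2 : mu_neg Lambda 2 = +oo%E.
Variables (d : measure_display) (Omega : measurableType d) (P : probability Omega R).
Variable Pi : R -> Omega -> nat -> nat -> bool.
Hypothesis coal : is_Lambda_coalescent Lambda P Pi.
Local Notation mu := (fine (mu_neg Lambda 1)).

Section Exit.
Import mathcomp.boot.fintype mathcomp.boot.finset.
Variable n : nat.
Local Notation sing := (Defs.singletons n).
Let q := \sum_(S in powerset sing | (2 <= #|S|)%N) lam Lambda #|sing| #|S|.

Lemma rate_to_singletons (z : {set {set 'I_n}}) : set0 \notin z -> rate Lambda z sing = 0.
Proof.
move=> z0; rewrite /rate big1// => S /andP[]; rewrite powersetE => /subsetP Sz.
move=> /andP[/card_gt1P[b1 [b2 [b1S b2S b12]]] /eqP mE].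
have : cover S \in sing by rewrite -mE !inE eqxx orbT.
move=> /imsetP[i _ cE].
have bi b : b \in S -> b = [set i]%SET.
  move=> bS; apply/eqP; rewrite eqEsubset; apply/andP; split.
    by rewrite -cE; apply: bigcup_sup.
  have /set0Pn[j jb] : b != set0 by apply: contraNneq z0 => <-; exact: Sz.
  have : j \in cover S by apply/bigcupP; exists b.
  by rewrite cE inE => /eqP ji; rewrite sub1set -ji.
by rewrite (bi _ b1S) (bi _ b2S) eqxx in b12.
Qed.

Lemma singletons_neq0 : set0 \notin sing.
Proof. by apply/imsetP => -[i _ /setP/(_ i)]; rewrite !inE eqxx. Qed.

Lemma derive_stay (t : R) : 0 <= t ->
  \sum_z trans Lambda t sing z * gen Lambda z sing = - q * trans Lambda t sing sing.
Proof.
move=> t0; rewrite (bigD1 sing)//= big1 ?addr0.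
  rewrite mulrC /gen rate_to_singletons ?singletons_neq0// eqxx mul1r sub0r.
  congr (- _ * _); have := rate_sum Lambda sing (fun=> 1).
  by under eq_bigr do rewrite mulr1; under [in RHS]eq_bigr do rewrite mulr1.
move=> z zs; have [z0|z0] := boolP (set0 \in z).
  rewrite -(pr_restr coal _ t0) (_ : mkset _ = classical_sets.set0) ?/pr ?measure0 ?mul0r//.
  apply/seteqP; split => // w /= wz; move: z0; rewrite -wz => /imsetP[i _ /setP/(_ i)].
  by rewrite !inE; have [-> _] := equiv_coal coal t w.
by rewrite /gen rate_to_singletons// (negbTE zs) mul0r subr0 mulr0.
Qed.

Lemma exit_rate_ge0 : 0 <= q.
Proof. by apply: sumr_ge0 => S _; exact: lam_ge0. Qed.

Lemma stay_mvt (a b : R) : 0 <= a -> a <= b -> exists2 c, a <= c <= b &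
  trans Lambda b sing sing - trans Lambda a sing sing =
  - q * trans Lambda c sing sing * (b - a).
Proof.
move=> a0 ab.
pose u t := trans Lambda t sing sing.
have du (t : R) : is_derive t 1 u (\sum_z trans Lambda t sing z * gen Lambda z sing).
  exact: is_derive_trans.
have ucont : {within `[a, b]%classic, continuous u}.
  by apply: derivable_within_continuous => r _; exact: ex_derive.
have [c + uc] := MVT_segment ab (fun r _ => du r) ucont.
rewrite in_itv /= => cab; exists c => //; have /andP[ac _] := cab.
by rewrite -derive_stay// (le_trans a0).
Qed.

Lemma pr_singletons_le (s : R) : 0 <= s ->
  s * q * pr P [set w | restr n (Pi s w) = sing]%classic <= 1.
Proof.
move=> s0; have [c /andP[c0 cs]] := stay_mvt (lexx 0) s0.
have [c' /andP[cc' _]] := stay_mvt c0 cs.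
rewrite trans0 eqxx -!(pr_restr coal) ?(le_trans c0 cc')// subr0 => E1 E2.
have q0 := exit_rate_ge0; set us := pr _ _ in E1 E2 *.
have us0 : 0 <= us by exact: pr_ge0.
set uc := pr _ _ in E1 E2; set uc' := pr _ _ in E1.
have le1 : us <= uc.
  rewrite -subr_le0 E1 !mulNr oppr_le0 !mulr_ge0 ?pr_ge0// subr_ge0//.
have : s * q * us <= s * q * uc by rewrite ler_wpM2l// mulr_ge0.
have {}E2 : us - 1 = - q * uc * s := E2.
by lra.
Qed.

Lemma pr_not_singletons_small (e : R) : 0 < e -> exists2 s : R, 0 < s &
  forall t, 0 <= t -> t <= s -> pr P [set w | restr n (Pi t w) != sing]%classic <= e.
Proof.
move=> e0.
pose C := \sum_(z : {set {set 'I_n}}) \sum_(S in powerset z | (2 <= #|S|)%N)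
  lam Lambda #|z| #|S|.
have C0 : 0 <= C by apply: sumr_ge0 => z _; apply: sumr_ge0 => S _; exact: lam_ge0.
have C1 : 0 < C + 1 by rewrite ltr_wpDl.
exists (e / (C + 1)); first by rewrite divr_gt0.
move=> t t0 te.
apply: le_trans (@pr_dynkin _ _ _ _ _ _ coal n 0 t (fun _ z => z != sing)
  (fun _ z => (z != sing)%:R) C (lexx 0) t0 _ _ _) _.
- by [].
- by move=> x z /= ->.
- move=> x z; apply: (@le_trans _ _ (\sum_(S in powerset z | (2 <= #|S|)%N) lam Lambda #|z| #|S|)).
    apply: ler_sum => S _; rewrite ler_piMr ?lam_ge0// lerBlDr.
    by apply: (@le_trans _ _ 1); [rewrite lern1 leq_b1|rewrite lerDl ler0n].
  rewrite /C [leRHS](bigD1 z)//= lerDl; apply: sumr_ge0 => z' _.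
  by apply: sumr_ge0 => S _; exact: lam_ge0.
rewrite big1 ?add0r ?subr0; last first.
  move=> x _; rewrite (pr_restr coal _ (lexx 0)) trans0 eq_sym.
  by case: (x == sing); rewrite ?mulr0 ?mul0r.
apply: (@le_trans _ _ ((C + 1) * t)); first by rewrite ler_wpM2r// lerDl.
by rewrite mulrC -ler_pdivlMr.
Qed.

End Exit.
End ManyBlocks.

Section InfiniteCase.
Variables (R : realType) (Lambda : {finite_measure set R -> \bar R}).
Hypothesis L1 : Lambda [set 1%R] = 0%E.
Hypothesis mu1 : (mu_neg Lambda 1 < +oo)%E.
Hypothesis mu2 : mu_neg Lambda 2 = +oo%E.
Variables (d : measure_display) (Omega : measurableType d) (P : probability Omega R).
Variable Pi : R -> Omega -> nat -> nat -> bool.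
Hypothesis coal : is_Lambda_coalescent Lambda P Pi.
Local Notation mu := (fine (mu_neg Lambda 1)).

Lemma measurable_nsb n m s k : measurable [set w | (#|nsb m (restr n (Pi s w))| < k)%N].
Proof. exact: (measurable_restr_pred coal s (fun x => (#|nsb m x| < k)%N)). Qed.

Lemma pr_nsb_mono n n' s k : (n <= n')%N ->
  pr P [set w | (#|nsb n' (restr n' (Pi s w))| < k)%N] <=
  pr P [set w | (#|nsb n (restr n (Pi s w))| < k)%N].
Proof.
move=> nn'; apply: le_pr; [exact: measurable_nsb..|move=> w /=].
by apply: leq_ltn_trans; apply: leq_nsb => //; exact: equiv_coal coal _ _.
Qed.

Lemma pr_singletons_small (s e : R) : 0 < s -> 0 < e -> exists n,
  pr P [set w | restr n (Pi s w) = Defs.singletons n] <= e.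
Proof.
move=> s0 e0; have [n] := exit_rate_unbounded L1 mu1 (s * e)^-1 mu2.
set q := \sum_(S in _ | _) _ => nq; exists n.
have := pr_singletons_le coal n (ltW s0); rewrite -/q.
set p := pr _ _ => H; have p0 : 0 <= p by exact: pr_ge0.
rewrite -[leRHS]mulr1 -ler_pdivrMl//; apply: le_trans H.
rewrite ler_wpM2r//; move: nq; rewrite invfM => nq.
by rewrite -ler_pdivrMl.
Qed.

(* A block of [E'] that is already a block of [E] contains at most one element
   below [m], hence differs from the block of [E'] with two such elements. *)
Lemma nsb_new_block n m k (E E' : nat -> nat -> bool) : (m <= n)%N ->
  Defs.equiv_rel E -> Defs.equiv_rel E' ->
  restr m E = Defs.singletons m -> restr m E' != Defs.singletons m ->
  (k <= #|nsb n (restr n E) :&: restr n E'|)%N -> (k < #|nsb n (restr n E')|)%N.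
Proof.
move=> mn eqE eqE' Es E's kC; set C := (_ :&: _) in kC.
have [b0 b0E'] : exists b0, b0 \in nsb m (restr n E').
  apply/finset.set0Pn; rewrite -card_gt0; apply: leq_trans (leq_nsb_restr mn eqE').
  by rewrite lt0n; apply: contraNneq E's => /(nsb_restr_eq0 eqE') ->.
have b0n : b0 \in nsb n (restr n E') by apply: (fintype.subsetP (nsb_subS _ mn)).
have b0C : b0 \notin C.
  apply/negP; rewrite inE => /andP[b0E _].
  have : b0 \in nsb m (restr n E).
    by move: b0E b0E'; rewrite !inE => /andP[-> _] /andP[_ ->].
  move=> /(nsb_restrP eqE)[i [j [im jm ij Eij _]]].
  have := joined_restr (Ordinal im) (Ordinal jm) eqE; rewrite /= Eij Es.
  move=> /exists_inP[b /imsetP[l _ ->]]; rewrite !inE => /andP[/eqP il /eqP jl].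
  by move: ij; rewrite -val_eqE /= -[i : nat]/(val (Ordinal im)) -[j : nat]/(val (Ordinal jm)) il jl eqxx.
have CE' : C \subset (nsb n (restr n E') :\ b0)%SET.
  apply/fintype.subsetP => b bC; rewrite in_setD1; apply/andP; split.
    by apply: contraNneq b0C => <-.
  by move: bC; rewrite !inE => /andP[/andP[_ ->] ->].
rewrite (cardsD1 b0) b0n add1n ltnS.
exact: leq_trans kC (subset_leq_card CE').
Qed.

Lemma many_blocks (k : nat) (s e : R) : 0 < s -> 0 < e -> exists n,
  pr P [set w | (#|nsb n (restr n (Pi s w))| < k)%N] <= k%:R * mu * s + e.
Proof.
have mu0 : 0 <= mu by exact: mu_ge0 L1 mu1.
elim: k s e => [|k IH] s e s0 e0.
  exists 0%N; rewrite (_ : mkset _ = set0); last by apply/seteqP; split.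
  by rewrite /pr measure0 !mul0r add0r ltW.
have e3 : 0 < e / 3 by rewrite divr_gt0.
have [m prm] := pr_singletons_small s0 e3.
have [s1 s10 Hs1] := pr_not_singletons_small coal m e3.
pose s' := Num.min s s1.
have s'0 : 0 < s' by rewrite lt_min s0.
have s's : s' <= s by rewrite ge_min lexx.
have s's1 : s' <= s1 by rewrite ge_min lexx orbT.
have prs' := Hs1 s' (ltW s'0) s's1.
have [n0 prn0] := IH s' (e / 3) s'0 e3.
pose n := maxn m n0; exists n.
have mn : (m <= n)%N by exact: leq_maxl.
have prn := le_trans (pr_nsb_mono s' k (leq_maxr m n0)) prn0.
have surv := survive_small L1 mu1 coal (@nsb_sub n n) k (ltW s'0) s's.
pose B1 := [set w | restr m (Pi s w) = Defs.singletons m].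
pose B2 := [set w | restr m (Pi s' w) != Defs.singletons m].
pose B3 := [set w | (#|(nsb n (restr n (Pi s' w)) :&: restr n (Pi s w))%SET| < k)%N].
have mB1 : measurable B1 by exact: measurable_restr coal _ _ _.
have mB2 : measurable B2.
  exact: (measurable_restr_pred coal s' (fun x => x != Defs.singletons m)).
have mB3 : measurable B3.
  exact: (measurable_restr_pred2 coal s' s (fun x z => (#|(nsb n x :&: z)%SET| < k)%N)).
have mB23 : measurable (B2 `|` B3) by exact: measurableU.
apply: (@le_trans _ _ (pr P (B1 `|` (B2 `|` B3)))).
  apply: le_pr; [exact: measurable_nsb|exact: measurableU|move=> w /= Kw].
  have [|E's] := eqVneq (restr m (Pi s w)) (Defs.singletons m); first by left.
  right; have [Es|] := eqVneq (restr m (Pi s' w)) (Defs.singletons m); last by left.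
  right; rewrite /B3 /= ltnNge; apply/negP => kC.
  have := nsb_new_block mn (equiv_coal coal s' w) (equiv_coal coal s w) Es E's kC.
  by rewrite ltnNge -ltnS Kw.
apply: le_trans (prU_le P mB1 mB23) _.
have := prU_le P mB2 mB3.
have : pr P B1 <= e / 3 by [].
have : pr P B2 <= e / 3 by [].
have : pr P B3 <= k%:R * mu * s' + e / 3 + k%:R * mu * (s - s').
  by apply: le_trans surv _; rewrite lerD2r.
have : 0 <= mu * s by rewrite mulr_ge0// ltW.
by rewrite -natr1; lra.
Qed.

Lemma many_common_blocks (k : nat) (T e : R) (s0 : R) : 0 < s0 -> s0 <= T -> 0 < e ->
  exists b m : nat, [/\ b.+1%:R^-1 <= s0 & exists B : set Omega, [/\ measurable B,
    [set w | (#|[set i : 'I_m | good (fun i => `[< forall l,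
       Pi b.+1%:R^-1 w i l = Pi T w i l >]) (Pi b.+1%:R^-1 w) i]%SET| < k)%N] `<=` B
    & pr P B <= e]].
Proof.
move=> s00 s0T e0; have T0 : 0 < T by exact: lt_le_trans s0T.
have mu0 : 0 <= mu by exact: mu_ge0 L1 mu1.
have e2 : 0 < e / 2 by rewrite divr_gt0.
have e4 : 0 < e / 4 by rewrite divr_gt0.
have [M HM] := survive_large L1 mu1 coal k (ltW T0) e2.
have c0 : 0 < e / 4 / (M%:R * mu + 1) by rewrite divr_gt0// ltr_wpDl// mulr_ge0.
pose s1 := Num.min s0 (e / 4 / (M%:R * mu + 1)).
have s10 : 0 < s1 by rewrite lt_min s00.
pose b := Num.truncn s1^-1; pose s : R := b.+1%:R^-1.
have ss1 : s <= s1 by rewrite invf_ple ?posrE//; exact/ltW/truncnS_gt.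
have s0' : 0 < s by rewrite invr_gt0.
have [m prm] := many_blocks M s0' e4.
have ss0 : s <= s0 by apply: le_trans ss1 _; rewrite ge_min lexx.
exists b, m; split => //.
have Ms : M%:R * mu * s <= e / 4.
  apply: (@le_trans _ _ ((M%:R * mu + 1) * (e / 4 / (M%:R * mu + 1)))).
    apply: ler_pM => //; [by rewrite mulr_ge0|exact: ltW|by rewrite lerDl|].
    by apply: le_trans ss1 _; rewrite ge_min lexx orbT.
  by rewrite mulrC divfK// gt_eqF// ltr_wpDl// mulr_ge0.
pose C n := [set w | (#|(nsb m (restr (m + n) (Pi s w)) :&: restr (m + n) (Pi T w))%SET| < k)%N].
have mC n : measurable (C n).
  exact: (measurable_restr_pred2 coal s T (fun x z => (#|(nsb m x :&: z)%SET| < k)%N)).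
exists (\bigcup_n C n); split.
- exact: bigcupT_measurable.
- move=> w /=; apply: contraPP => nC; apply/negP; rewrite -leqNgt.
  apply: card_common_limit; [exact: equiv_coal coal _ _..|].
  move=> n mn; rewrite leqNgt; apply/negP => Cn; apply: nC.
  by exists (n - m)%N => //; rewrite /C /= subnKC.
- apply: pr_bigcup_le => //.
    move=> n n' nn'; apply/subsetPset => w; rewrite /C /=.
    apply: leq_ltn_trans; apply: leq_common; rewrite ?leq_addr ?leq_add2l//.
      exact: equiv_coal coal _ _.
    exact: equiv_coal coal _ _.
  move=> n; have sT : s <= T by exact: le_trans s0T.
  have tsT : T - s <= T by rewrite gerBl ltW.
  have H := HM (m + n)%N (@nsb (m + n) m) s T (@nsb_sub _ _) (ltW s0') sT tsT; apply: le_trans H _.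
  have : pr P [set w | (#|nsb m (restr (m + n) (Pi s w))| < M)%N] <=
      pr P [set w | (#|nsb m (restr m (Pi s w))| < M)%N].
    apply: le_pr; [exact: measurable_nsb..|move=> w /=].
    by apply: leq_ltn_trans; apply: leq_nsb_restr; [exact: leq_addr|exact: equiv_coal coal _ _].
  by lra.
Qed.

Section AtomicBlocksInBetween.
Import mathcomp.finmap.finmap.

(* Blocks common to [Pi s] and [Pi T] are blocks of every [Pi t] in between, so
   their frequencies need to be controlled at the fixed time [s] only. *)
Lemma card_good_atomic_blocks (t : R) w :
  finite_set (atomic_blocks R (Pi t w)) -> exists k, forall (s T : R) m,
  (forall i j, Pi s w i j -> Pi t w i j) -> (forall i j, Pi t w i j -> Pi T w i j) ->
  (forall i j, i != j -> Pi s w i j -> atomic R (Pi s w i)) ->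
  (#|[set i : 'I_m | good (fun i => `[< forall l,
     Pi s w i l = Pi T w i l >]) (Pi s w) i]%SET| <= k)%N.
Proof.
move=> finA; exists #|` fset_set (atomic_blocks R (Pi t w))| => s T m st tT at_s.
set G := [set i : 'I_m | _]%SET.
pose F (i : 'I_m) := [set l | Pi s w i l].
have [refl [sym tr]] := equiv_coal coal s w.
have ijP i : i \in G -> (forall l : 'I_m, (l < i)%N -> ~~ Pi s w i l) /\
    (exists2 l : 'I_m, l != i & Pi s w i l) /\ (forall l, Pi s w i l = Pi T w i l).
  rewrite inE => /and3P[/forallP H1 /existsP[l /andP[li Hl]] /asboolP H3].
  by split; [move=> l' l'i; exact: (implyP (H1 l'))|split=> //; exists l].
have F_atomic i : i \in G -> F i \in fset_set (atomic_blocks R (Pi t w)).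
  move=> /ijP[_ [[l li sil] sT]]; rewrite in_fset_set//; apply/mem_set.
  have stE : Pi t w i = Pi s w i.
    by apply/funext => j; apply/idP/idP => [/tT|/st//]; rewrite sT.
  exists i; rewrite stE; split => //.
  by apply: at_s sil; rewrite eq_sym.
have Finj : {in G &, injective F}.
  move=> i j iG jG FE; have [imin _] := ijP i iG; have [jmin _] := ijP j jG.
  have sij : Pi s w i j.
    have Fjj : F j j by exact: refl.
    by rewrite -FE in Fjj.
  have [lt|lt|/ord_inj//] := ltngtP (i : nat) (j : nat).
    by move: (jmin _ lt); rewrite sym.
  by move: (imin _ lt); rewrite sij.
have us : uniq [seq F i | i <- enum G].
  by rewrite map_inj_in_uniq ?enum_uniq// => i j; rewrite !mem_enum; exact: Finj.
rewrite cardE -(size_map F).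
apply: uniq_leq_size => // _ /mapP[i + ->]; rewrite mem_enum; exact: F_atomic.
Qed.

End AtomicBlocksInBetween.

Lemma ae_infinite_atomic_blocks : {ae P, forall w, forall t : R, 0 < t ->
  ~ finite_set (atomic_blocks R (Pi t w))}.
Proof.
pose A (j : nat) := [set w | ~ exists b m : nat, b.+1%:R^-1 <= j.+1%:R^-1 :> R /\
  (j <= #|[set i : 'I_m | good (fun i => `[< forall l,
       Pi b.+1%:R^-1 w i l = Pi j.+1%:R w i l >]) (Pi b.+1%:R^-1 w) i]%SET|)%N].
have A0 j : P.-negligible (A j).
  apply: negligible_small => e e0.
  have j0 : 0 < j.+1%:R^-1 :> R by rewrite invr_gt0.
  have jj : j.+1%:R^-1 <= j.+1%:R :> R.
    by apply: (@le_trans _ _ 1); [rewrite invf_le1 ?ler1n|rewrite ler1n].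
  have [b [m [bj [B [mB sB prB]]]]] := many_common_blocks j j0 jj e0.
  exists B; split => // w Aw; apply: sB => /=; rewrite ltnNge; apply/negP => jG.
  by apply: Aw; exists b, m.
pose N (q : nat * (nat * nat)) := [set w | q.2.1 != q.2.2 /\
  (Pi q.1.+1%:R^-1 w q.2.1 q.2.2 /\ ~ atomic R (Pi q.1.+1%:R^-1 w q.2.1))].
have N0 q : P.-negligible (N q).
  case: q => b [i j]; rewrite /N /=; have [ij|ij] := eqVneq i j.
    by apply: negligibleS (negligible_set0 P) => w /= [].
  have b0 : 0 <= b.+1%:R^-1 :> R by rewrite invr_ge0.
  by apply: negligibleS (negligible_not_atomic coal b0 ij) => w /= [].
pose NF k := if unpickle k is Some q then N q else set0.
have NF0 : P.-negligible (\bigcup_k NF k).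
  apply: negligible_bigcup => k; rewrite /NF; case: unpickle => [q|]; first exact: N0.
  exact: negligible_set0.
have := negligibleU (negligibleU (negligible_bigcup A0) NF0) (ae_coal_refine coal).
apply: negligibleS => w /= H; apply: contrapT => /not_orP[/not_orP[nA nN] /contrapT nR].
apply: H => t t0 finA.
have [k Hk] := card_good_atomic_blocks finA.
pose j := maxn k.+1 (maxn (Num.truncn t) (Num.truncn t^-1)).
have tj : t <= j.+1%:R.
  apply: ltW; apply: lt_le_trans (truncnS_gt t) _.
  by rewrite ler_nat ltnS (leq_trans _ (leq_maxr _ _))// leq_maxl.
have jt : j.+1%:R^-1 <= t.
  rewrite invf_ple ?posrE//; apply: ltW; apply: lt_le_trans (truncnS_gt _) _.
  by rewrite ler_nat ltnS (leq_trans _ (leq_maxr _ _))// leq_maxr.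
have [b [m [bj jG]]] : exists b m : nat, b.+1%:R^-1 <= j.+1%:R^-1 :> R /\
  (j <= #|[set i : 'I_m | good (fun i => `[< forall l,
       Pi b.+1%:R^-1 w i l = Pi j.+1%:R w i l >]) (Pi b.+1%:R^-1 w) i]%SET|)%N.
  by apply: contrapT => nG; apply: nA; exists j.
have b0 : 0 <= b.+1%:R^-1 :> R by rewrite invr_ge0.
suff at_s : forall i j, i != j -> Pi b.+1%:R^-1 w i j -> atomic R (Pi b.+1%:R^-1 w i).
  have := Hk _ _ m (nR _ _ b0 (le_trans bj jt)) (nR _ _ (ltW t0) tj) at_s.
  by move=> /(leq_trans jG); apply/negP; rewrite -ltnNge; exact: leq_maxl.
move=> i i' ii' wii'; apply: contrapT => nat_; apply: nN.
have NE : NF (pickle (b, (i, i'))) = N (b, (i, i')) by rewrite /NF pickleK.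
by exists (pickle (b, (i, i'))); [exact: I|rewrite NE].
Qed.

End InfiniteCase.

Theorem theorem3 (R : realType) (Lambda : {finite_measure set R -> \bar R})
    (d : measure_display) (Omega : measurableType d) (P : probability Omega R)
    (Pi : R -> Omega -> nat -> nat -> bool) :
  Lambda (~` `[0%R, 1%R]) = 0%E ->
  Lambda [set 1%R] = 0%E ->
  is_Lambda_coalescent Lambda P Pi ->
  (mu_neg Lambda 1 < +oo)%E ->
  ((mu_neg Lambda 2 = +oo)%E ->
     {ae P, forall w, forall t : R, 0 < t -> ~ finite_set (atomic_blocks R (Pi t w))}) /\
  ((mu_neg Lambda 2 < +oo)%E ->
     {ae P, forall w, forall t : R, 0 < t -> finite_set (atomic_blocks R (Pi t w))}).
Proof.
move=> _ L1 coal mu1; split => mu2.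
- exact: (ae_infinite_atomic_blocks L1 mu1 mu2 coal).
- exact: (ae_finite_atomic_blocks L1 mu1 mu2 coal).
Qed.
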